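(* Let $n\ge3$, $k\in\mathbb N$ and $\ell\in[n]$. The basis functions $\psi_{\mathbf j}$ of $\mathcal M_k^q(\mathbb R^n)$ (with $\mathbf j=(j_1,\dots,j_{n-1})\in\mathbb N^{n-1}$, $\sum_ij_i=k$) satisfy the spherical $q$-Dirac-Dunkl equation $$\Gamma_{[\ell]}^q\psi_{\mathbf j}=\lambda_\ell(\mathbf j)\psi_{\mathbf j},\qquad\lambda_\ell(\mathbf j)=(-1)^{|\mathbf j_{\ell-1}|}\left[|\mathbf j_{\ell-1}|+\gamma_{[\ell]}-\tfrac12\right]_q,$$ where $|\mathbf j_{\ell-1}|=j_1+\dots+j_{\ell-1}$.
   Context: Let $q$ be a nonzero complex number with $|q|\neq1$ (fix a logarithm of $q$ to define $q^a$ for real $a$). Notation: $[a]_q=\frac{q^a-q^{-a}}{q-q^{-1}}$, $\{X,Y\}=XY+YX$, $[j]=\{1,\dots,j\}$; the empty sum $|\mathbf j_0|$ is $0$. **The algebra.** $\mathfrak{osp}_q(1|2)$ is the unital associative $\mathbb C$-algebra with generators $A_+,A_-,K,K^{-1},P$ and relations $KA_{\pm}K^{-1}=q^{\pm1/2}A_\pm$, $\{A_+,A_-\}=\frac{K^2-K^{-2}}{q^{1/2}-q^{-1/2}}$, $\{P,A_\pm\}=0$, $[P,K]=[P,K^{-1}]=0$, $KK^{-1}=K^{-1}K=1$, $P^2=1$. Tensor powers carry the standard (ungraded) componentwise product. $\Delta$ is the algebra morphism with $\Delta(A_\pm)=A_\pm\otimes KP+K^{-1}\otimes A_\pm$, $\Delta(K)=K\otimes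 K$, $\Delta(P)=P\otimes P$; $\Delta^{(0)}=\mathrm{id}$, $\Delta^{(r)}=(1^{\otimes(r-1)}\otimes\Delta)\Delta^{(r-1)}$. The Casimir element is $\Gamma^q=\left(-A_+A_-+\frac{q^{-1/2}K^2-q^{1/2}K^{-2}}{q-q^{-1}}\right)P$. Put $\Gamma^q_{[\ell]}=\Delta^{(\ell-1)}(\Gamma^q)\otimes1^{\otimes(n-\ell)}\in\mathfrak{osp}_q(1|2)^{\otimes n}$. **Realization.** $\mathcal P(\mathbb R^j)$ is the space of complex-valued polynomials in $x_1,\dots,x_j$ and $\mathcal P_k(\mathbb R^j)$ its homogeneous part of degree $k$. Fix $\mu_1,\dots,\mu_n>0$, $\gamma_i=\mu_i+\frac12$, $\gamma_{[j]}=\sum_{i\le j}\gamma_i$. Let $r_i$ be the substitution $x_i\mapsto-x_i$ and $T_{q,i}^{s}$ the substitution $x_i\mapsto q^sx_i$, and $$D_i^q=\frac{q^{\mu_i}}{q-q^{-1}}\,\frac{T_{q,i}-r_i}{x_i}-\frac{q^{-\mu_i}}{q-q^{-1}}\,\frac{T_{q,i}^{-1}-r_i}{x_i}.$$ $\mathfrak{osp}_q(1|2)^{\otimes n}$ acts on $\mathcal P(\mathbb R^n)$ by letting, in the $i$-th tensor factor, $A_+\mapsto x_i$, $A_-\mapsto D_i^q$, $K\mapsto q^{\gamma_i/2}T_{q,i}^{1/2}$, $P\mapsto r_i$; $\Gamma^q_{[\ell]}$ also denotes the resulting operator. **Monogenics and basis.** For $1\le j\le n$, $$D_{[j]}^q=\sum_{i=1}^jD_i^qR_{[j],i}^q,\quad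 X_{[j]}^q=\sum_{i=1}^jx_iR_{[j],i}^q,\quad R^q_{[j],i}=\Big(\prod_{l<i}q^{-\gamma_l/2}T_{q,l}^{-1/2}\Big)\Big(\prod_{i<l\le j}q^{\gamma_l/2}T_{q,l}^{1/2}r_l\Big)\Big(\prod_{j<l\le n}r_l\Big),$$ and $\mathcal M_k^q(\mathbb R^j)=\ker(D_{[j]}^q)\cap\mathcal P_k(\mathbb R^j)$. For $2\le j\le n$ the map $\mathbf{CK}_{x_j}^{\mu_j}:\mathcal P_k(\mathbb R^{j-1})\to\mathcal M_k^q(\mathbb R^j)$ is, for each $k$, $$\mathbf{CK}_{x_j}^{\mu_j}=\sum_{\alpha=0}^k\frac{(-1)^{\alpha(\alpha+1)/2}q^{\frac{\alpha}{2}(\gamma_{[j]}+k-1)}}{[\mu_j,\alpha;q][\mu_j,\alpha-1;q]\cdots[\mu_j,1;q]}\,x_j^\alpha\left(D_{[j-1]}^q\right)^\alpha,\qquad[\mu_j,m;q]=[\mu_j+m]_q-(-1)^m[\mu_j]_q.$$ For $\mathbf j\in\mathbb N^{n-1}$, $$\psi_{\mathbf j}=\mathbf{CK}_{x_n}^{\mu_n}\Big[(X_{[n-1]}^q)^{j_{n-1}}\mathbf{CK}_{x_{n-1}}^{\mu_{n-1}}\Big[\cdots\Big[(X_{[2]}^q)^{j_2}\mathbf{CK}_{x_2}^{\mu_2}(x_1^{j_1})\Big]\cdots\Big]\Big].$$ *)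

(* Defs.v *)
From HB Require Import structures.
From mathcomp Require Import all_boot all_order all_algebra.
From mathcomp Require Import boolp reals.
From mathcomp Require sequences exp trigo.
From mathcomp Require Import generic_quotient ring.
From mathcomp Require Import complex mpoly.
Set Implicit Arguments.
Unset Strict Implicit.
Unset Printing Implicit Defensive.
Import Order.TTheory GRing.Theory Num.Theory.
Local Open Scope ring_scope.

Definition alg_morphism (K : comNzRingType) (A B : algType K) (f : A -> B) :=
  linear f /\ monoid_morphism f.

(* Algebras with a counit, i.e. a character to the ground ring. The counit is *)
(* only there to ensure 1 != 0, which the library's algType demands, in the   *)
(* algebras given by generators and relations below.                          *)
HB.mixin Record hasCounit (K : comNzRingType) A of GRing.Algebra K A := {
  counit : A -> K^o;
  counit_morphism : linear counit /\ monoid_morphism counit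
}.
#[short(type="counitAlgType")]
HB.structure Definition CounitAlgebra (K : comNzRingType) :=
  {A of GRing.Algebra K A & hasCounit K A}.


Inductive aexpr (K X : Type) : Type :=
| avar of X
| azero
| aone
| aadd of aexpr K X & aexpr K X
| aopp of aexpr K X
| amul of aexpr K X & aexpr K X
| ascale of K & aexpr K X.
Arguments avar {K X}.
Arguments azero {K X}.
Arguments aone {K X}.

Declare Scope aexpr_scope.
Delimit Scope aexpr_scope with AE.
Bind Scope aexpr_scope with aexpr.
Notation "0" := azero : aexpr_scope.
Notation "1" := aone : aexpr_scope.
Notation "a + b" := (aadd a b) : aexpr_scope.
Notation "- a" := (aopp a) : aexpr_scope.
Notation "a - b" := (aadd a (aopp b)) : aexpr_scope.
Notation "a * b" := (amul a b) : aexpr_scope.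
Notation "c *: a" := (ascale c%R a) : aexpr_scope.

HB.instance Definition _ (K X : Type) := gen_eqMixin (aexpr K X).
HB.instance Definition _ (K X : Type) := gen_choiceMixin (aexpr K X).

Fixpoint aeval (K : comNzRingType) (X : Type) (B : algType K) (f : X -> B) (a : aexpr K X) : B :=
  match a with
  | avar x => f x
  | azero => 0
  | aone => 1
  | aadd a b => aeval f a + aeval f b
  | aopp a => - aeval f a
  | amul a b => aeval f a * aeval f b
  | ascale c a => c *: aeval f a
  end.

Definition satisfies (K : comNzRingType) (X : Type)
    (rel : aexpr K X -> aexpr K X -> Prop) (B : algType K) (f : X -> B) :=
  forall a b, rel a b -> aeval f a = aeval f b.

Section PresentedAlgebra.
Context (K : comNzRingType) (X : Type).
Context (rel : aexpr K X -> aexpr K X -> Prop).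
Context (eps : X -> K^o) (epsP : satisfies rel eps).

(* The congruence generated by rel and the axioms of unital associative       *)
(* K-algebras: its quotient is the free algebra on X modulo the two-sided     *)
(* ideal of the a - b with rel a b.                                           *)
Inductive acong : aexpr K X -> aexpr K X -> Prop :=
| acong_rel a b : rel a b -> acong a b
| acong_refl a : acong a a
| acong_sym a b : acong a b -> acong b a
| acong_trans b a c : acong a b -> acong b c -> acong a c
| acong_add a a' b b' : acong a a' -> acong b b' -> acong (a + b) (a' + b')
| acong_opp a a' : acong a a' -> acong (- a) (- a')
| acong_mul a a' b b' : acong a a' -> acong b b' -> acong (a * b) (a' * b')
| acong_scale c a a' : acong a a' -> acong (c *: a) (c *: a')
| acong_addA a b c : acong (a + (b + c)) (a + b + c)
| acong_addC a b : acong (a + b) (b + a)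
| acong_add0 a : acong (0 + a) a
| acong_addN a : acong (- a + a) 0
| acong_mulA a b c : acong (a * (b * c)) (a * b * c)
| acong_1mul a : acong (1 * a) a
| acong_mul1 a : acong (a * 1) a
| acong_mulDl a b c : acong ((a + b) * c) (a * c + b * c)
| acong_mulDr a b c : acong (a * (b + c)) (a * b + a * c)
| acong_scaleA c d a : acong (c *: (d *: a)) ((c * d) *: a)
| acong_scale1 a : acong (1 *: a) a
| acong_scaleDr c a b : acong (c *: (a + b)) (c *: a + c *: b)
| acong_scaleDl c d a : acong ((c + d) *: a) (c *: a + d *: a)
| acong_scaleAl c a b : acong (c *: (a * b)) ((c *: a) * b)
| acong_scaleAr c a b : acong (c *: (a * b)) (a * (c *: b)).

Lemma aeval_acong (B : algType K) (f : X -> B) (fP : satisfies rel f) a b :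
  acong a b -> aeval f a = aeval f b.
Proof.
elim=> //=; do ?[by move=> *; congruence].
- by move=> *; rewrite addrA.
- by move=> *; rewrite addrC.
- by move=> *; rewrite add0r.
- by move=> *; rewrite addNr.
- by move=> *; rewrite mulrA.
- by move=> *; rewrite mul1r.
- by move=> *; rewrite mulr1.
- by move=> *; rewrite mulrDl.
- by move=> *; rewrite mulrDr.
- by move=> *; rewrite scalerA.
- by move=> *; rewrite scale1r.
- by move=> *; rewrite scalerDr.
- by move=> *; rewrite scalerDl.
- by move=> *; rewrite scalerAl.
- by move=> *; rewrite scalerAr.
Qed.

Definition acongb (a b : aexpr K X) : bool := `[< acong a b >].

Lemma acongb_refl : reflexive acongb.
Proof. by move=> a; apply/asboolP; apply: acong_refl. Qed.
Lemma acongb_sym : ssrbool.symmetric acongb.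
Proof.
by move=> a b; apply/idP/idP => /asboolP ab; apply/asboolP; apply: acong_sym.
Qed.
Lemma acongb_trans : transitive acongb.
Proof.
move=> b a c /asboolP ab /asboolP bc; apply/asboolP.
exact: acong_trans ab bc.
Qed.

Canonical acong_equiv := EquivRel acongb acongb_refl acongb_sym acongb_trans.

Definition presAlg of satisfies rel eps : Type := {eq_quot acongb}%qT.
Local Notation pA := (presAlg epsP).
HB.instance Definition _ := Choice.on pA.
HB.instance Definition _ := EqQuotient.on pA.

Definition pcls (a : aexpr K X) : pA := \pi_pA%qT a.

Lemma pclsP a b : pcls a = pcls b <-> acong a b.
Proof.
rewrite /pcls; split; first by move/eqmodP => /asboolP.
by move=> ab; apply/eqmodP/asboolP.
Qed.

Lemma reprP_acong a : acong (repr (pcls a)) a.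
Proof. by apply/pclsP; rewrite /pcls reprK. Qed.

Lemma pcls_repr (u : pA) : pcls (repr u) = u.
Proof. by rewrite /pcls reprK. Qed.

Definition pzero := pcls 0.
Definition pone := pcls 1.
Definition padd (u v : pA) := pcls (repr u + repr v).
Definition popp (u : pA) := pcls (- repr u).
Definition pmul (u v : pA) := pcls (repr u * repr v).
Definition pscale (c : K) (u : pA) := pcls (c *: repr u).

Lemma paddE a b : padd (pcls a) (pcls b) = pcls (a + b).
Proof. by apply/pclsP; apply: acong_add; apply: reprP_acong. Qed.
Lemma poppE a : popp (pcls a) = pcls (- a).
Proof. by apply/pclsP; apply: acong_opp; apply: reprP_acong. Qed.
Lemma pmulE a b : pmul (pcls a) (pcls b) = pcls (a * b).
Proof. by apply/pclsP; apply: acong_mul; apply: reprP_acong. Qed.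
Lemma pscaleE c a : pscale c (pcls a) = pcls (c *: a).
Proof. by apply/pclsP; apply: acong_scale; apply: reprP_acong. Qed.
Definition pclsE := (paddE, poppE, pmulE, pscaleE).

Lemma pcls_ind (P : pA -> Prop) : (forall a, P (pcls a)) -> forall u, P u.
Proof. by move=> Pa u; rewrite -(pcls_repr u). Qed.

Ltac pres := do ?[elim/pcls_ind => ?];
  rewrite ?/pzero ?/pone !pclsE; apply/pclsP; by constructor.

Lemma paddA : associative padd. Proof. pres. Qed.
Lemma paddC : commutative padd. Proof. pres. Qed.
Lemma padd0 : left_id pzero padd. Proof. pres. Qed.
Lemma paddN : left_inverse pzero popp padd. Proof. pres. Qed.
HB.instance Definition _ := GRing.isZmodule.Build pA paddA paddC padd0 paddN.

Lemma pmulA : associative pmul. Proof. pres. Qed.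
Lemma p1mul : left_id pone pmul. Proof. pres. Qed.
Lemma pmul1 : right_id pone pmul. Proof. pres. Qed.
Lemma pmulDl : left_distributive pmul padd. Proof. pres. Qed.
Lemma pmulDr : right_distributive pmul padd. Proof. pres. Qed.
Lemma pone_neq0 : pone != pzero.
Proof.
apply/eqP => /pclsP /(aeval_acong epsP) /eqP; by rewrite /= oner_eq0.
Qed.
HB.instance Definition _ :=
  GRing.Zmodule_isNzRing.Build pA pmulA p1mul pmul1 pmulDl pmulDr pone_neq0.

Lemma pscaleA c d u : pscale c (pscale d u) = pscale (c * d) u.
Proof. by elim/pcls_ind: u => ?; pres. Qed.
Lemma pscale1 : left_id 1 pscale. Proof. pres. Qed.
Lemma pscaleDr : right_distributive pscale padd.
Proof. by move=> c; pres. Qed.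
Lemma pscaleDl u : {morph pscale^~ u : c d / c + d >-> padd c d}.
Proof. by move=> c d; elim/pcls_ind: u => ?; pres. Qed.
HB.instance Definition _ :=
  GRing.Zmodule_isLmodule.Build K pA pscaleA pscale1 pscaleDr pscaleDl.

Lemma pscaleAl (c : K) (u v : pA) : c *: (u * v) = (c *: u) * v.
Proof.
by elim/pcls_ind: u => ?; elim/pcls_ind: v => ?; rewrite /GRing.scale /GRing.mul /=; pres.
Qed.
HB.instance Definition _ := GRing.Lmodule_isLalgebra.Build K pA pscaleAl.
Lemma pscaleAr (c : K) (u v : pA) : c *: (u * v) = u * (c *: v).
Proof.
by elim/pcls_ind: u => ?; elim/pcls_ind: v => ?; rewrite /GRing.scale /GRing.mul /=; pres.
Qed.
HB.instance Definition _ := GRing.Lalgebra_isAlgebra.Build K pA pscaleAr.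

Definition pgen (x : X) : pA := pcls (avar x).

(* Meaningful only if f satisfies the relations; it is then the unique        *)
(* algebra morphism that extends f (presLift_morphism, presLift_unique).      *)
Definition presLift (B : algType K) (f : X -> B) (u : pA) : B :=
  aeval f (repr u).

Section Lift.
Context (B : algType K) (f : X -> B) (fP : satisfies rel f).

Lemma presLiftE a : presLift f (pcls a) = aeval f a.
Proof. exact: (aeval_acong fP) (reprP_acong a). Qed.

Lemma presLift_gen x : presLift f (pgen x) = f x.
Proof. exact: presLiftE. Qed.

Lemma presLift_morphism : alg_morphism (presLift f).
Proof.
split; [|split].
- move=> c u v; rewrite -(pcls_repr u) -(pcls_repr v).
  rewrite -[c *: pcls _]/(pscale _ _) -[_ + pcls _]/(padd _ _) !pclsE.
  by rewrite !presLiftE.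
- by rewrite -[1]/pone presLiftE.
- move=> u v; rewrite -(pcls_repr u) -(pcls_repr v).
  by rewrite -[pcls _ * pcls _]/(pmul _ _) !pclsE !presLiftE.
Qed.

End Lift.

Lemma alg_morphism_aeval (B : algType K) (g : pA -> B) :
  alg_morphism g -> forall a, g (pcls a) = aeval (g \o pgen) a.
Proof.
move=> [lg [g1 gM]].
have gD u v : g (u + v) = g u + g v by rewrite -[u in LHS]scale1r lg scale1r.
have g0 : g 0 = 0 by apply: (addrI (g 0)); rewrite -gD !addr0.
have gZ c u : g (c *: u) = c *: g u by rewrite -[c *: u]addr0 lg g0 addr0.
have gN u : g (- u) = - g u by rewrite -scaleN1r gZ scaleN1r.
elim=> //=.
- by move=> a IHa b IHb; rewrite -paddE [LHS]gD IHa IHb.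
- by move=> a IHa; rewrite -poppE [LHS]gN IHa.
- by move=> a IHa b IHb; rewrite -pmulE [LHS]gM IHa IHb.
- by move=> c a IHa; rewrite -pscaleE [LHS]gZ IHa.
Qed.

Lemma presLift_unique (B : algType K) (f : X -> B) (g : pA -> B) :
  alg_morphism g -> (forall x, g (pgen x) = f x) -> g =1 presLift f.
Proof.
move=> gP gf u; rewrite -[in LHS](pcls_repr u) alg_morphism_aeval // /presLift.
by congr (aeval _ _); apply/funext.
Qed.

Lemma pgen_satisfies : satisfies rel pgen.
Proof.
have E a : aeval pgen a = pcls a.
  have idP : alg_morphism (@idfun pA) by [].
  exact/esym/(alg_morphism_aeval idP a).
by move=> a b ab; rewrite !E; apply/pclsP; apply: acong_rel.
Qed.

End PresentedAlgebra.

Arguments pcls {K X rel eps epsP} a.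
Arguments pgen {K X rel eps epsP} x.

Lemma presLift_counit (K : comNzRingType) (X : Type)
    (rel : aexpr K X -> aexpr K X -> Prop) (eps : X -> K^o)
    (epsP : satisfies rel eps) :
  alg_morphism (presLift eps : presAlg epsP -> K^o).
Proof. exact: presLift_morphism. Qed.

HB.instance Definition _ (K : comNzRingType) (X : Type)
    (rel : aexpr K X -> aexpr K X -> Prop) (eps : X -> K^o)
    (epsP : satisfies rel eps) :=
  hasCounit.Build K (presAlg epsP) (presLift_counit epsP).


(* The tensor product of two algebras is presented by its pure tensors: the   *)
(* relations are bilinearity and the componentwise product.                   *)
Section Tensor.
Context (K : comNzRingType) (A B : counitAlgType K).
Local Notation pt a b := (@avar K (A * B) (a%R, b%R)).

Inductive tens_rel : aexpr K (A * B) -> aexpr K (A * B) -> Prop :=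
| tens_addl a a' b : tens_rel (pt (a + a') b) (pt a b + pt a' b)
| tens_addr a b b' : tens_rel (pt a (b + b')) (pt a b + pt a b')
| tens_scalel c a b : tens_rel (pt (c *: a) b) (c *: pt a b)
| tens_scaler c a b : tens_rel (pt a (c *: b)) (c *: pt a b)
| tens_mul a a' b b' : tens_rel (pt a b * pt a' b') (pt (a * a') (b * b'))
| tens_one : tens_rel (pt 1 1) 1.

Definition bal (E : algType K) (f : A -> E) (g : B -> E) (p : A * B) : E :=
  f p.1 * g p.2.

Lemma bal_satisfies (E : algType K) (f : A -> E) (g : B -> E) :
  alg_morphism f -> alg_morphism g -> (forall a b, f a * g b = g b * f a) ->
  satisfies tens_rel (bal f g).
Proof.
move=> [fl [f1 fM]] [gl [g1 gM]] fg.
have fD u v : f (u + v) = f u + f v by rewrite -[u in LHS]scale1r fl scale1r.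
have f0 : f 0 = 0 by apply: (addrI (f 0)); rewrite -fD !addr0.
have fZ c u : f (c *: u) = c *: f u by rewrite -[c *: u]addr0 fl f0 addr0.
have gD u v : g (u + v) = g u + g v by rewrite -[u in LHS]scale1r gl scale1r.
have g0 : g 0 = 0 by apply: (addrI (g 0)); rewrite -gD !addr0.
have gZ c u : g (c *: u) = c *: g u by rewrite -[c *: u]addr0 gl g0 addr0.
move=> _ _ [] * /=; rewrite /bal /=.
- by rewrite fD mulrDl.
- by rewrite gD mulrDr.
- by rewrite fZ scalerAl.
- by rewrite gZ scalerAr.
- by rewrite fM gM -!mulrA; congr (_ * _); rewrite !mulrA fg.
- by rewrite f1 g1 mulr1.
Qed.

Definition tens_counit : A * B -> K^o := bal (@counit K A) (@counit K B).

Lemma tens_counitP : satisfies tens_rel tens_counit.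
Proof.
by apply: bal_satisfies; [exact: counit_morphism..|move=> a b; apply: mulrC].
Qed.

Definition tens : counitAlgType K := presAlg tens_counitP.
Definition pure (a : A) (b : B) : tens := pgen (a, b).

Lemma pureDl a a' b : pure (a + a') b = pure a b + pure a' b.
Proof. exact: pgen_satisfies (tens_addl a a' b). Qed.
Lemma pureDr a b b' : pure a (b + b') = pure a b + pure a b'.
Proof. exact: pgen_satisfies (tens_addr a b b'). Qed.
Lemma pureZl c a b : pure (c *: a) b = c *: pure a b.
Proof. exact: pgen_satisfies (tens_scalel c a b). Qed.
Lemma pureZr c a b : pure a (c *: b) = c *: pure a b.
Proof. exact: pgen_satisfies (tens_scaler c a b). Qed.
Lemma pureNl a b : pure (- a) b = - pure a b.
Proof. by rewrite -scaleN1r pureZl scaleN1r. Qed.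
Lemma pureNr a b : pure a (- b) = - pure a b.
Proof. by rewrite -scaleN1r pureZr scaleN1r. Qed.
Lemma pureM a a' b b' : pure a b * pure a' b' = pure (a * a') (b * b').
Proof. exact: pgen_satisfies (tens_mul a a' b b'). Qed.
Lemma pure1 : pure 1 1 = 1.
Proof. exact: pgen_satisfies tens_one. Qed.

Definition tensLift (E : algType K) (f : A -> E) (g : B -> E) : tens -> E :=
  presLift (bal f g).

Section TensLift.
Context (E : algType K) (f : A -> E) (g : B -> E).
Hypotheses (fP : alg_morphism f) (gP : alg_morphism g).
Hypothesis fg : forall a b, f a * g b = g b * f a.

Lemma tensLift_morphism : alg_morphism (tensLift f g).
Proof. exact/presLift_morphism/bal_satisfies. Qed.

Lemma tensLift_pure a b : tensLift f g (pure a b) = f a * g b.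
Proof. exact: (presLift_gen _ (bal_satisfies fP gP fg)). Qed.
End TensLift.

End Tensor.
Arguments pure {K A B} a b.

Definition idTens (K : comNzRingType) (A B B' : counitAlgType K)
    (g : B -> B') : tens A B -> tens A B' :=
  tensLift (pure^~ 1) (fun b => pure 1 (g b)).

Section IdTens.
Context (K : comNzRingType) (A B B' : counitAlgType K) (g : B -> B').

Lemma purel_morphism : alg_morphism (pure^~ 1 : A -> tens A B').
Proof.
split=> [c a a'|]; first by rewrite pureDl pureZl.
by split=> [|a a']; [exact: pure1 | rewrite pureM mulr1].
Qed.

Hypothesis gP : alg_morphism g.

Lemma purer_morphism : alg_morphism (fun b => pure 1 (g b) : tens A B').
Proof.
case: gP => gl [g1 gM].
split=> [c a a'|]; first by rewrite gl pureDr pureZr.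
by split=> [|a a']; [rewrite g1 pure1 | rewrite gM pureM mulr1].
Qed.

Let purelr_comm (a : A) b :
  pure a 1 * pure 1 (g b) = pure 1 (g b) * pure a 1 :> tens A B'.
Proof. by rewrite !pureM !mul1r !mulr1. Qed.

Lemma idTens_morphism : alg_morphism (idTens g : tens A B -> tens A B').
Proof.
exact: tensLift_morphism purel_morphism purer_morphism purelr_comm.
Qed.

Lemma idTens_pure (a : A) b : idTens g (pure a b) = pure a (g b).
Proof.
rewrite /idTens (tensLift_pure purel_morphism purer_morphism purelr_comm).
by rewrite pureM mul1r mulr1.
Qed.
End IdTens.

(* tpow A m is the (m+1)-fold power, A (x) (A (x) (... (x) A)).               *)
Fixpoint tpow (K : comNzRingType) (A : counitAlgType K) (m : nat) :
    counitAlgType K :=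
  if m is m'.+1 then tens A (tpow A m') else A.

(* t |-> t (x) 1 (x) ... (x) 1, from the (l+1)-fold to the (m+1)-fold power;  *)
(* the value 0 for l > m is a dummy.                                          *)
Fixpoint tpad (K : comNzRingType) (A : counitAlgType K) (l m : nat) :
    tpow A l -> tpow A m :=
  match l, m with
  | 0, 0 => id
  | 0, m'.+1 => fun a => pure a 1
  | l'.+1, m'.+1 => idTens (@tpad K A l' m')
  | _.+1, 0 => fun=> 0
  end.

(* 1^(x)r (x) D, for an algebra morphism D : A -> A (x) A                     *)
Fixpoint tlast (K : comNzRingType) (A : counitAlgType K) (D : A -> tens A A)
    (r : nat) : tpow A r -> tpow A r.+1 :=
  if r is r'.+1 then idTens (@tlast K A D r') else D.

Fixpoint iterDelta (K : comNzRingType) (A : counitAlgType K)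
    (D : A -> tens A A) (r : nat) : A -> tpow A r :=
  if r is r'.+1 then fun a => tlast D (iterDelta D r' a) else id.

Section IterDelta.
Context (K : comNzRingType) (A : counitAlgType K) (D : A -> tens A A).
Hypothesis DP : alg_morphism D.

Lemma tlast_morphism r : alg_morphism (@tlast K A D r).
Proof. by elim: r => [|r IHr] //=; exact: idTens_morphism. Qed.

Lemma iterDelta_morphism r : alg_morphism (@iterDelta K A D r).
Proof.
elim: r => [|r [IHl [IH1 IHM]]] //=; have [tl [t1 tM]] := tlast_morphism r.
by split=> [c a b|]; [rewrite IHl tl | split=> [|a b]; rewrite ?IH1 ?IHM].
Qed.
End IterDelta.

Lemma tpad_morphism (K : comNzRingType) (A : counitAlgType K) (l m : nat) :
  (l <= m)%N -> alg_morphism (@tpad K A l m).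
Proof.
elim: l m => [|l IHl] [|m] //= lm; first exact: purel_morphism.
exact/idTens_morphism/IHl.
Qed.

(* The action of the tensor power, the i-th factor acting through f i;        *)
(* meaningful if the f i are algebra morphisms with values that commute for   *)
(* distinct i (tact_morphism).                                                *)
Fixpoint tact (K : comNzRingType) (A : counitAlgType K) (E : algType K)
    (m : nat) : ('I_m.+1 -> A -> E) -> tpow A m -> E :=
  if m is m'.+1 then
    fun f => tensLift (f ord0) (tact (fun i : 'I_m'.+1 => f (lift ord0 i)))
  else fun f => f ord0.

Lemma presLift_comm (K : comNzRingType) (X : Type)
    (rel : aexpr K X -> aexpr K X -> Prop) (eps : X -> K^o)
    (epsP : satisfies rel eps) (E : algType K) (f : X -> E) (z : E) :
  (forall x, z * f x = f x * z) ->
  forall u : presAlg epsP, z * presLift f u = presLift f u * z.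
Proof.
move=> zf u; rewrite /presLift; elim: (repr u) => //=.
- by rewrite mulr0 mul0r.
- by rewrite mulr1 mul1r.
- by move=> a IHa b IHb; rewrite mulrDr mulrDl IHa IHb.
- by move=> a IHa; rewrite mulrN mulNr IHa.
- by move=> a IHa b IHb; rewrite mulrA IHa -mulrA IHb mulrA.
- by move=> c a IHa; rewrite -scalerAr IHa scalerAl.
Qed.

Section TactMorphism.
Context (K : comNzRingType) (A : counitAlgType K) (E : algType K).

Lemma tact_comm (z : E) (m : nat) (f : 'I_m.+1 -> A -> E) :
  (forall i a, z * f i a = f i a * z) ->
  forall u : tpow A m, z * tact f u = tact f u * z.
Proof.
elim: m f => [|m IHm] f zf u /=; first exact: zf.
apply: presLift_comm => -[a b]; rewrite /bal /=.
by rewrite mulrA zf -!mulrA IHm // => i c; exact: zf.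
Qed.

Lemma tact_morphism_comm (m : nat) (f : 'I_m.+1 -> A -> E) :
  (forall i, alg_morphism (f i)) ->
  (forall i j a b, i != j -> f i a * f j b = f j b * f i a) ->
  alg_morphism (tact f : tpow A m -> E) /\
  (if m is m'.+1 return ('I_m.+1 -> A -> E) -> Prop then fun f =>
     forall a (b : tpow A m'), tact f (pure a b : tpow A m'.+1) =
       f ord0 a * tact (fun i => f (lift ord0 i)) b
   else fun=> True) f.
Proof.
elim: m f => [|m IHm] f fP fC; first by split; [exact: fP|].
have [] := IHm (fun i => f (lift ord0 i)) (fun i => fP _).
  by move=> i j a b ij; apply: fC; rewrite (inj_eq lift_inj).
move=> tP _; have C a (b : tpow A m) :
    f ord0 a * tact (fun i => f (lift ord0 i)) b =
    tact (fun i => f (lift ord0 i)) b * f ord0 a.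
  by apply: tact_comm => i c; apply: fC; exact: neq_lift.
by split; [exact: tensLift_morphism|exact: tensLift_pure].
Qed.

Lemma tact_morphism (m : nat) (f : 'I_m.+1 -> A -> E) :
  (forall i, alg_morphism (f i)) ->
  (forall i j a b, i != j -> f i a * f j b = f j b * f i a) ->
  alg_morphism (tact f : tpow A m -> E).
Proof. by move=> fP fC; case: (tact_morphism_comm fP fC). Qed.

Lemma tact_pure (m : nat) (f : 'I_m.+2 -> A -> E) :
  (forall i, alg_morphism (f i)) ->
  (forall i j a b, i != j -> f i a * f j b = f j b * f i a) ->
  forall a (b : tpow A m), tact f (pure a b : tpow A m.+1) =
    f ord0 a * tact (fun i => f (lift ord0 i)) b.
Proof. by move=> fP fC; case: (tact_morphism_comm fP fC). Qed.

End TactMorphism.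


Section LinEnd.
Context (K : comNzRingType) (V : lalgType K).

Definition linEnd : Type := {linear V -> V}.
Definition lapp (f : linEnd) : V -> V := f.

Lemma linEndP (f g : linEnd) : lapp f =1 lapp g <-> f = g.
Proof.
split=> [|->//] /funext; case: f g => [f cf] [g cg].
rewrite /lapp /= => fg; case: _ / fg cg => cg.
case: cf cg => -[a1] [b1] [] -[a2] [b2].
by rewrite (Prop_irrelevance a1 a2) (Prop_irrelevance b1 b2).
Qed.

HB.instance Definition _ := gen_eqMixin linEnd.
HB.instance Definition _ := gen_choiceMixin linEnd.

Definition lzero : linEnd := (\0 : V -> V).
Definition lone : linEnd := (@idfun V).
Definition ladd (f g : {linear V -> V}) : linEnd := f \+ g.
Definition lopp (f : {linear V -> V}) : linEnd := \- f.
Definition lmul (f g : {linear V -> V}) : linEnd := f \o g.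
Definition lscale (c : K) (f : {linear V -> V}) : linEnd := c \*: f.

Ltac lin := move=> *; apply/linEndP => ? /=.
Lemma laddA : associative ladd. Proof. by lin; rewrite /= addrA. Qed.
Lemma laddC : commutative ladd. Proof. by lin; rewrite /= addrC. Qed.
Lemma ladd0 : left_id lzero ladd. Proof. by lin; rewrite /= add0r. Qed.
Lemma laddN : left_inverse lzero lopp ladd.
Proof. by lin; rewrite /= addNr. Qed.
HB.instance Definition _ :=
  GRing.isZmodule.Build linEnd laddA laddC ladd0 laddN.

Lemma lmulA : associative lmul. Proof. by lin. Qed.
Lemma l1mul : left_id lone lmul. Proof. by lin. Qed.
Lemma lmul1 : right_id lone lmul. Proof. by lin. Qed.
Lemma lmulDl : left_distributive lmul ladd. Proof. by lin. Qed.
Lemma lmulDr : right_distributive lmul ladd.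
Proof. by lin; rewrite /lapp /= raddfD. Qed.
Lemma lone_neq0 : lone != lzero.
Proof. by apply/eqP => /linEndP /(_ 1) /eqP; rewrite /= oner_eq0. Qed.
HB.instance Definition _ :=
  GRing.Zmodule_isNzRing.Build linEnd lmulA l1mul lmul1 lmulDl lmulDr lone_neq0.

Lemma lscaleA c d f : lscale c (lscale d f) = lscale (c * d) f.
Proof. by lin; rewrite /= scalerA. Qed.
Lemma lscale1 : left_id 1 lscale. Proof. by lin; rewrite /= scale1r. Qed.
Lemma lscaleDr : right_distributive lscale ladd.
Proof. by lin; rewrite /= scalerDr. Qed.
Lemma lscaleDl f : {morph lscale^~ f : c d / c + d >-> ladd c d}.
Proof. by lin; rewrite /= scalerDl. Qed.
HB.instance Definition _ :=
  GRing.Zmodule_isLmodule.Build K linEnd lscaleA lscale1 lscaleDr lscaleDl.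

Lemma lscaleAl (c : K) (f g : linEnd) : c *: (f * g) = (c *: f) * g.
Proof. by apply/linEndP. Qed.
HB.instance Definition _ := GRing.Lmodule_isLalgebra.Build K linEnd lscaleAl.
Lemma lscaleAr (c : K) (f g : linEnd) : c *: (f * g) = f * (c *: g).
Proof. by apply/linEndP => p; rewrite /lapp /= linearZ. Qed.
HB.instance Definition _ := GRing.Lalgebra_isAlgebra.Build K linEnd lscaleAr.

Lemma lappD (f g : linEnd) p : lapp (f + g) p = lapp f p + lapp g p.
Proof. by []. Qed.
Lemma lappN (f : linEnd) p : lapp (- f) p = - lapp f p.
Proof. by []. Qed.
Lemma lappM (f g : linEnd) p : lapp (f * g) p = lapp f (lapp g p).
Proof. by []. Qed.
Lemma lappZ (c : K) (f : linEnd) p : lapp (c *: f) p = c *: lapp f p.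
Proof. by []. Qed.
Lemma lappZr (f : linEnd) (c : K) p : lapp f (c *: p) = c *: lapp f p.
Proof. exact: linearZ. Qed.
Lemma lapp1 p : lapp 1 p = p. Proof. by []. Qed.
Lemma lapp0 p : lapp 0 p = 0. Proof. by []. Qed.

Definition mkLinEnd (f : V -> V) (lf : linear f) : linEnd :=
  HB.pack_for {linear V -> V} f (GRing.isLinear.Build K V V *:%R f lf).

End LinEnd.
Arguments lapp {K V} f p : simpl never.



Section QPow.
Context (R : realType).
Implicit Types (h z : R[i]) (a b : R).

Definition cexp z : R[i] :=
  let: (x +i* y)%C := z in
  ((sequences.expR x * trigo.cos y) +i* (sequences.expR x * trigo.sin y))%C.

(* q^a, where h is the chosen logarithm of q = cexp h.                        *)
Definition qpow h a : R[i] := cexp ((a%:C)%C * h).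

Definition qnum h a : R[i] :=
  (qpow h a - qpow h (- a)) / (cexp h - (cexp h)^-1).

Lemma cexpD z w : cexp (z + w) = cexp z * cexp w.
Proof.
case: z w => [x y] [x' y']; apply/eqP; rewrite eq_complex /=.
rewrite exp.expRD trigo.cosD trigo.sinD; apply/andP.
by split; apply/eqP; ring.
Qed.

Lemma cexp0 : cexp 0 = 1.
Proof.
apply/eqP; rewrite eq_complex /= exp.expR0 trigo.cos0 trigo.sin0.
by rewrite mulr1 mulr0 !eqxx.
Qed.

Lemma qpowD h a b : qpow h (a + b) = qpow h a * qpow h b.
Proof. by rewrite /qpow rmorphD mulrDl cexpD. Qed.

Lemma qpow0 h : qpow h 0 = 1.
Proof. by rewrite /qpow rmorph0 mul0r cexp0. Qed.

Lemma qpow1 h : qpow h 1 = cexp h.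
Proof. by rewrite /qpow rmorph1 mul1r. Qed.

Lemma qpow_neq0 h a : qpow h a != 0.
Proof.
apply/eqP => ha; have /eqP := qpow0 h.
by rewrite -(subrr a) qpowD ha mul0r eq_sym oner_eq0.
Qed.

Lemma qpowN h a : qpow h (- a) = (qpow h a)^-1.
Proof.
apply: (mulIf (qpow_neq0 h a)).
by rewrite -qpowD addNr qpow0 mulVf // qpow_neq0.
Qed.

Lemma qpowM_nat h a k : qpow h (a * k%:R) = qpow h a ^+ k.
Proof.
elim: k => [|k IHk]; first by rewrite mulr0 qpow0.
by rewrite -addn1 natrD mulrDr mulr1 qpowD IHk exprD.
Qed.

Lemma cexp_neq0 h : cexp h != 0.
Proof. by rewrite -qpow1 qpow_neq0. Qed.

Lemma qsub_neq0 h : `|cexp h| != 1 -> cexp h - (cexp h)^-1 != 0.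
Proof.
move=> h1; apply: contra h1 => /eqP/subr0_eq e.
have q2 : cexp h ^+ 2 = 1 by rewrite expr2 {2}e mulfV // cexp_neq0.
by rewrite -(@pexpr_eq1 _ _ 2) // -normrX q2 normr1.
Qed.

Lemma qhalf_sub_neq0 h : `|cexp h| != 1 ->
  qpow h 2^-1 - qpow h (- 2^-1) != 0.
Proof.
move=> h1; apply: contra h1 => /eqP/subr0_eq e.
have q1 : cexp h = 1.
  rewrite -qpow1 [X in qpow h X](splitr 1) mul1r qpowD {2}e.
  by rewrite -qpowD subrr qpow0.
by rewrite q1 normr1.
Qed.

End QPow.


Inductive osp_gen := gAp | gAm | gK | gKi | gP.

Section Osp.
Context (R : realType) (h : R[i]).
Local Notation C := R[i].
Local Notation q := (cexp h).
Local Notation qhalf := (qpow h 2^-1).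
Local Notation qhalfN := (qpow h (- 2^-1)).

Let xAp := @avar C _ gAp.
Let xAm := @avar C _ gAm.
Let xK := @avar C _ gK.
Let xKi := @avar C _ gKi.
Let xP := @avar C _ gP.

Inductive osp_rel : aexpr C osp_gen -> aexpr C osp_gen -> Prop :=
| osp_KAp : osp_rel (xK * xAp * xKi) (qhalf *: xAp)
| osp_KAm : osp_rel (xK * xAm * xKi) (qhalfN *: xAm)
| osp_ApAm : osp_rel (xAp * xAm + xAm * xAp)
    ((qhalf - qhalfN)^-1 *: (xK * xK - xKi * xKi))
| osp_PAp : osp_rel (xP * xAp + xAp * xP) 0
| osp_PAm : osp_rel (xP * xAm + xAm * xP) 0
| osp_PK : osp_rel (xP * xK) (xK * xP)
| osp_PKi : osp_rel (xP * xKi) (xKi * xP)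
| osp_KKi : osp_rel (xK * xKi) 1
| osp_KiK : osp_rel (xKi * xK) 1
| osp_PP : osp_rel (xP * xP) 1.

Definition osp_counit (g : osp_gen) : C^o :=
  match g with gAp | gAm => 0 | gK | gKi | gP => 1 end.

Lemma osp_counitP : satisfies osp_rel osp_counit.
Proof.
by move=> _ _ [] /=;
  rewrite ?(mulr0, mul0r, mulr1, scaler0, addr0, subrr).
Qed.

Definition osp : counitAlgType C := presAlg osp_counitP.
Definition Aplus : osp := pgen gAp.
Definition Aminus : osp := pgen gAm.
Definition Kosp : osp := pgen gK.
Definition Kinv : osp := pgen gKi.
Definition Posp : osp := pgen gP.

Definition Delta_gen (g : osp_gen) : tens osp osp :=
  match g with
  | gAp => pure Aplus (Kosp * Posp) + pure Kinv Aplus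
  | gAm => pure Aminus (Kosp * Posp) + pure Kinv Aminus
  | gK => pure Kosp Kosp
  | gKi => pure Kinv Kinv
  | gP => pure Posp Posp
  end.

Definition Delta : osp -> tens osp osp := presLift Delta_gen.

(* Delta^{(r)}, with values in the (r+1)-fold tensor power                    *)
Definition Deltan (r : nat) : osp -> tpow osp r := iterDelta Delta r.

Definition Casimir : osp :=
  (- (Aplus * Aminus) + (q - q^-1)^-1 *:
     (qhalfN *: Kosp ^+ 2 - qhalf *: Kinv ^+ 2)) * Posp.

(* Delta^{(l-1)}(Casimir) (x) 1^{(x)(n-l)}                                    *)
Definition CasimirOn (n l : nat) : tpow osp n.-1 :=
  tpad n.-1 (Deltan l.-1 Casimir).

Lemma KAplus : Kosp * Aplus = qhalf *: (Aplus * Kosp).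
Proof.
have /= E := pgen_satisfies osp_counitP osp_KAp.
have /= V := pgen_satisfies osp_counitP osp_KiK.
by rewrite scalerAl -[qhalf *: _]E -[RHS]mulrA V mulr1.
Qed.
Lemma KAminus : Kosp * Aminus = qhalfN *: (Aminus * Kosp).
Proof.
have /= E := pgen_satisfies osp_counitP osp_KAm.
have /= V := pgen_satisfies osp_counitP osp_KiK.
by rewrite scalerAl -[qhalfN *: _]E -[RHS]mulrA V mulr1.
Qed.
Lemma KKinv : Kosp * Kinv = 1.
Proof. exact: (pgen_satisfies osp_counitP osp_KKi). Qed.
Lemma KinvK : Kinv * Kosp = 1.
Proof. exact: (pgen_satisfies osp_counitP osp_KiK). Qed.
Lemma PospP : Posp * Posp = 1.
Proof. exact: (pgen_satisfies osp_counitP osp_PP). Qed.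
Lemma PKosp : Posp * Kosp = Kosp * Posp.
Proof. exact: (pgen_satisfies osp_counitP osp_PK). Qed.
Lemma PKinv : Posp * Kinv = Kinv * Posp.
Proof. exact: (pgen_satisfies osp_counitP osp_PKi). Qed.
Lemma PAplus : Posp * Aplus = - (Aplus * Posp).
Proof.
apply/eqP; rewrite -addr_eq0; apply/eqP.
exact: (pgen_satisfies osp_counitP osp_PAp).
Qed.
Lemma PAminus : Posp * Aminus = - (Aminus * Posp).
Proof.
apply/eqP; rewrite -addr_eq0; apply/eqP.
exact: (pgen_satisfies osp_counitP osp_PAm).
Qed.
Lemma AplusAminus : Aplus * Aminus + Aminus * Aplus =
  (qhalf - qhalfN)^-1 *: (Kosp ^+ 2 - Kinv ^+ 2).
Proof. by rewrite !expr2; exact: (pgen_satisfies osp_counitP osp_ApAm). Qed.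

Lemma qhalfK : qhalf * qhalfN = 1.
Proof. by rewrite -qpowD subrr qpow0. Qed.

Lemma KinvAplus : Kinv * Aplus = qhalfN *: (Aplus * Kinv).
Proof.
have E : Kinv * (Kosp * Aplus) * Kinv = qhalf *: (Kinv * Aplus).
  by rewrite KAplus -scalerAr -scalerAl -!mulrA KKinv mulr1.
have {E} : Aplus * Kinv = qhalf *: (Kinv * Aplus) by rewrite -E mulrA KinvK mul1r.
by move=> ->; rewrite scalerA mulrC qhalfK scale1r.
Qed.
Lemma KinvAminus : Kinv * Aminus = qhalf *: (Aminus * Kinv).
Proof.
have E : Kinv * (Kosp * Aminus) * Kinv = qhalfN *: (Kinv * Aminus).
  by rewrite KAminus -scalerAr -scalerAl -!mulrA KKinv mulr1.
have {E} : Aminus * Kinv = qhalfN *: (Kinv * Aminus).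
  by rewrite -E mulrA KinvK mul1r.
by move=> ->; rewrite scalerA qhalfK scale1r.
Qed.

Lemma Delta_satisfies : satisfies osp_rel Delta_gen.
Proof.
have KA s A (H : Kosp * A = s *: (A * Kosp)) : pure Kosp Kosp *
    (pure A (Kosp * Posp) + pure Kinv A) * pure Kinv Kinv =
    s *: (pure A (Kosp * Posp) + pure Kinv A).
  rewrite mulrDr mulrDl !pureM scalerDr; congr (_ + _).
    rewrite H -scalerAl -(mulrA A) KKinv mulr1 pureZl; congr (_ *: pure _ _).
    by rewrite -!mulrA PKinv (mulrA Kosp Kinv) KKinv mul1r.
  by rewrite H -scalerAl -(mulrA A) KKinv mulr1 pureZr mul1r.
have PA A (H : Posp * A = - (A * Posp)) : pure Posp Posp *
    (pure A (Kosp * Posp) + pure Kinv A) +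
    (pure A (Kosp * Posp) + pure Kinv A) * pure Posp Posp = 0.
  rewrite mulrDr mulrDl !pureM H mulrA PKosp PKinv.
  rewrite -(scaleN1r (A * Posp)) pureZl pureZr addrACA.
  by rewrite !scaleN1r !addNr addr0.
move=> _ _ [] /=.
- exact/KA/KAplus.
- exact/KA/KAminus.
- rewrite !mulrDl !mulrDr !pureM.
  have -> : Kinv * Aplus = qhalfN *: (Aplus * Kinv) := KinvAplus.
  have -> : Kinv * Aminus = qhalf *: (Aminus * Kinv) := KinvAminus.
  have -> : Kosp * Posp * Aminus = - (qhalfN *: (Aminus * (Kosp * Posp))).
    by rewrite -mulrA PAminus mulrN (mulrA Kosp) KAminus -scalerAl mulrA.
  have -> : Kosp * Posp * Aplus = - (qhalf *: (Aplus * (Kosp * Posp))).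
    by rewrite -mulrA PAplus mulrN (mulrA Kosp) KAplus -scalerAl mulrA.
  have -> : Kosp * Posp * (Kosp * Posp) = Kosp * Kosp.
    by rewrite mulrA -(mulrA Kosp Posp) PKosp mulrA -mulrA PospP mulr1.
  rewrite !(pureNr, pureZl, pureZr).
  set a := pure (Aplus * Aminus) _; set d := pure _ (Aplus * Aminus).
  set b := qhalfN *: _; set c := qhalf *: _.
  set a' := pure (Aminus * Aplus) _; set d' := pure _ (Aminus * Aplus).
  have -> : a - b + (c + d) + (a' - c + (b + d')) = a + a' + (d + d').
    rewrite addrACA (addrACA a) (addrACA c) -opprD [c + b]addrC -addrA.
    by rewrite (addrA (- (b + c))) addNr add0r.
  rewrite /a /a' /d /d' -pureDl -pureDr AplusAminus pureZl pureZr -scalerDr.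
  rewrite !expr2.
  by rewrite pureDl pureDr pureNl pureNr addrA subrK.
- exact/PA/PAplus.
- exact/PA/PAminus.
- by rewrite !pureM PKosp.
- by rewrite !pureM PKinv.
- by rewrite pureM KKinv pure1.
- by rewrite pureM KinvK pure1.
- by rewrite pureM PospP pure1.
Qed.

Lemma Delta_morphism : alg_morphism Delta.
Proof. exact/presLift_morphism/Delta_satisfies. Qed.

Lemma Delta_pgen g : Delta (pgen g) = Delta_gen g.
Proof. exact: (presLift_gen _ Delta_satisfies). Qed.

Lemma Deltan_morphism r : alg_morphism (Deltan r).
Proof. exact/iterDelta_morphism/Delta_morphism. Qed.

End Osp.


Section Realization.
Context (R : realType) (h : R[i]) (n : nat) (mu : 'I_n.+1 -> R).
Local Notation C := R[i].
Local Notation V := {mpoly C[n.+1]}.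
Local Notation q := (cexp h).
Implicit Types (i l : 'I_n.+1) (m : 'X_{1..n.+1}) (p : V).

Lemma lappE_monom (f g : linEnd V) :
  (forall m, lapp f 'X_[m] = lapp g 'X_[m]) -> f = g.
Proof.
move=> fg; apply/linEndP => p; rewrite [p]mpolyE /lapp !linear_sum /=.
by apply: eq_bigr => m _; rewrite !linearZ /=; congr (_ *: _); apply: fg.
Qed.

Definition subst_fun i (c : C) p : V :=
  p \mPo [tuple (if l == i then c *: 'X_l else 'X_l) | l < n.+1].

Lemma subst_is_linear i c : linear (subst_fun i c).
Proof. by move=> a p p'; rewrite /subst_fun linearP. Qed.

Definition substX i c : linEnd V := mkLinEnd (subst_is_linear i c).

Definition Tq i (a : R) : linEnd V := substX i (qpow h a).
Definition reflX i : linEnd V := substX i (-1).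

Lemma mulX_is_linear i : linear (fun p => 'X_i * p).
Proof. by move=> a p p'; rewrite mulrDr -scalerAr. Qed.

Definition mulX i : linEnd V := mkLinEnd (mulX_is_linear i).

(* Division by x_i; the monomials in which x_i does not occur, absent from    *)
(* the polynomials to which D^q_i applies it, are sent to 0.                  *)
Definition divX_fun i p : V :=
  \sum_(m <- msupp p | (0 < m i)%N) p@_m *: 'X_[m - U_(i)].

Lemma divX_coeff i p m : (divX_fun i p)@_m = p@_(m + U_(i)).
Proof.
rewrite /divX_fun raddf_sum /=.
under eq_bigr => m' m'i.
  rewrite mcoeffZ mcoeffX.
  have -> : ((m' - U_(i))%MM == m) = (m' == (m + U_(i))%MM).
    apply/eqP/eqP => [<-|->]; last by rewrite addmK.
    by rewrite submK // lep1mP -lt0n.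
  over.
have mi : (0 < (m + U_(i))%MM i)%N by rewrite mnmDE mnm1E eqxx addn1.
case: (boolP ((m + U_(i))%MM \in msupp p)) => [pm|pm].
  rewrite big_mkcond (bigD1_seq _ pm) ?msupp_uniq //= mi eqxx mulr1.
  by rewrite big1 ?addr0 // => m' /negPf ->; rewrite mulr0 if_same.
rewrite memN_msupp_eq0 // big1_seq // => m' /andP[_ m'p].
case: eqP => [e|_]; last by rewrite mulr0.
by rewrite -e m'p in pm.
Qed.

Lemma divX_is_linear i : linear (divX_fun i).
Proof.
by move=> a p p'; apply/mpolyP => m; rewrite !(divX_coeff, mcoeffD, mcoeffZ).
Qed.

Definition divX i : linEnd V := mkLinEnd (divX_is_linear i).

Definition Dq i : linEnd V :=
  (qpow h (mu i) / (q - q^-1)) *: (divX i * (Tq i 1 - reflX i)) -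
  (qpow h (- mu i) / (q - q^-1)) *: (divX i * (Tq i (-1) - reflX i)).

Definition gam i : R := mu i + 2^-1.

Definition osp_act_gen i (g : osp_gen) : linEnd V :=
  match g with
  | gAp => mulX i
  | gAm => Dq i
  | gK => qpow h (gam i / 2) *: Tq i 2^-1
  | gKi => qpow h (- (gam i / 2)) *: Tq i (- 2^-1)
  | gP => reflX i
  end.

Definition osp_act i : osp h -> linEnd V := presLift (osp_act_gen i).

Definition osp_tact : tpow (osp h) n -> linEnd V := tact osp_act.

Lemma substXE i c m : lapp (substX i c) 'X_[m] = c ^+ m i *: 'X_[m].
Proof.
rewrite /lapp /= /subst_fun comp_mpolyX (bigD1 i) //= tnth_mktuple eqxx.
rewrite exprZn -scalerAl; congr (_ *: _).
rewrite [RHS](mpolyXE_id C m) [RHS](bigD1 i) //=; congr (_ * _).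
by apply: eq_bigr => l /negPf li; rewrite tnth_mktuple li.
Qed.

Lemma mulXE i m : lapp (mulX i) 'X_[m] = 'X_[m + U_(i)].
Proof. by rewrite /lapp /= -mpolyXD addmC. Qed.

Lemma divXE i m : (0 < m i)%N -> lapp (divX i) 'X_[m] = 'X_[m - U_(i)].
Proof.
move=> mi; apply/mpolyP => m'; rewrite divX_coeff !mcoeffX; congr (_ %:R).
congr (nat_of_bool _); apply/eqP/eqP => [->|<-]; first by rewrite addmK.
by rewrite submK // lep1mP -lt0n.
Qed.

(* [mu_i, k; q]                                                               *)
Definition mubr i (k : nat) : C :=
  qnum h (mu i + k%:R) - (-1) ^+ k * qnum h (mu i).

Lemma DqE i m : lapp (Dq i) 'X_[m] = mubr i (m i) *: 'X_[m - U_(i)].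
Proof.
have E c s : lapp (c *: (divX i * (Tq i s - reflX i))) 'X_[m] =
    (c * (qpow h (s * (m i)%:R) - (-1) ^+ m i)) *: lapp (divX i) 'X_[m].
  rewrite lappZ lappM -[lapp (_ - _) _]/(lapp (Tq i s) _ - lapp (reflX i) _).
  by rewrite !substXE -scalerBl lappZr scalerA qpowM_nat.
rewrite -[LHS]/(lapp (_ *: _) _ - lapp (_ *: _) _) !E -scalerBl.
have [m0|mi] := posnP (m i).
  rewrite /mubr m0 !mulr0 qpow0 expr0 addr0 mul1r !subrr !mulr0 subrr.
  by rewrite !scale0r.
rewrite divXE //; congr (_ *: _).
rewrite /mubr /qnum opprD !qpowD mul1r mulN1r.
move: (_ - _)^-1 => s; ring.
Qed.

Lemma mubr0 i : mubr i 0 = 0.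
Proof. by rewrite /mubr addr0 expr0 mul1r subrr. Qed.

Lemma Kact_E i m : lapp (osp_act_gen i gK) 'X_[m] =
  qpow h ((gam i + (m i)%:R) / 2) *: 'X_[m].
Proof.
rewrite lappZ substXE -qpowM_nat scalerA -qpowD; congr (qpow h _ *: _).
by field.
Qed.

Lemma Kiact_E i m : lapp (osp_act_gen i gKi) 'X_[m] =
  qpow h (- ((gam i + (m i)%:R) / 2)) *: 'X_[m].
Proof.
rewrite lappZ substXE -qpowM_nat scalerA -qpowD; congr (qpow h _ *: _).
by field.
Qed.

Lemma Pact_E i m : lapp (osp_act_gen i gP) 'X_[m] = (-1) ^+ m i *: 'X_[m].
Proof. exact: substXE. Qed.

Lemma Apact_E i m : lapp (osp_act_gen i gAp) 'X_[m] = 'X_[m + U_(i)].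
Proof. exact: mulXE. Qed.

Lemma Amact_E i m :
  lapp (osp_act_gen i gAm) 'X_[m] = mubr i (m i) *: 'X_[m - U_(i)].
Proof. exact: DqE. Qed.

Definition osp_actE := (Kact_E, Kiact_E, Pact_E, Apact_E, Amact_E).

Lemma mnmDUE i m : (m + U_(i))%MM i = (m i).+1.
Proof. by rewrite mnmDE mnm1E eqxx addn1. Qed.

Lemma mnmBUE i m : (m - U_(i))%MM i = (m i).-1.
Proof. by rewrite mnmBE mnm1E eqxx subn1. Qed.

Lemma mubrB i m (c : C) m' : ((0 < m i)%N -> c *: 'X_[m'] = 'X_[m] :> V) ->
  c *: (mubr i (m i) *: 'X_[m']) = mubr i (m i) *: 'X_[m] :> V.
Proof.
case: posnP => [->|_ <- //]; first by rewrite mubr0 !scale0r scaler0.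
by rewrite !scalerA mulrC.
Qed.

Section Satisfies.
Hypothesis h1 : `|q| != 1.

Lemma splitr_half : 1 = 2^-1 + 2^-1 :> R.
Proof. by field. Qed.

Lemma mubr_sum i k : mubr i k + mubr i k.+1 =
  (qpow h 2^-1 - qpow h (- 2^-1))^-1 *
  (qpow h (gam i + k%:R) - qpow h (- (gam i + k%:R))).
Proof.
have d0 := qhalf_sub_neq0 h1; have := qsub_neq0 h1.
rewrite /mubr /qnum exprS -natr1 -qpow1 -qpowN.
have -> : mu i + (k%:R + 1) = gam i + k%:R + 2^-1 by rewrite /gam; field.
have -> : mu i + k%:R = gam i + k%:R - 2^-1 by rewrite /gam; field.
have e1 : qpow h 1 = qpow h 2^-1 * qpow h 2^-1.
  by rewrite -qpowD -splitr_half.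
have e2 : qpow h (- 1) = qpow h (- 2^-1) * qpow h (- 2^-1).
  by rewrite -qpowD -opprD -splitr_half.
move: (gam i + k%:R) => g; rewrite e1 e2 !(opprD, qpowD, opprK) => d1.
move: d0 d1; move: (qpow h 2^-1) (qpow h (- 2^-1)) => x y d0 d1.
have d2 : x * x - y * y = (x - y) * (x + y) by ring.
move: d1; rewrite d2 mulf_eq0 negb_or => /andP[_ d1].
by field; rewrite d0 d1.
Qed.

Lemma osp_act_satisfies i : satisfies (@osp_rel R h) (osp_act_gen i).
Proof.
move: (Kact_E i) (Kiact_E i) (Pact_E i) (Apact_E i) (Amact_E i).
move: (osp_act_gen i) => f KE KiE PE ApE AmE.
move=> _ _ [] /=; apply: lappE_monom => m;
  rewrite ?lappM ?lappZ ?lapp1 ?lapp0.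
- rewrite KiE !lappZr ApE KE scalerA -qpowD mnmDUE; congr (qpow h _ *: _).
  by rewrite -natr1; field.
- rewrite KiE !lappZr AmE !lappZr KE mnmBUE !scalerA.
  case: (posnP (m i)) => [->|mi]; first by rewrite mubr0 !(mulr0, mul0r).
  congr (_ *: _); rewrite mulrAC -qpowD; congr (qpow h _ * _).
  have -> : (m i)%:R = (m i).-1%:R + 1 :> R by rewrite natr1 prednK.
  by field.
- rewrite lappD !lappM AmE lappZr !ApE AmE mnmDUE addmK.
  have -> : mubr i (m i) *: 'X_[m - U_(i) + U_(i)] = mubr i (m i) *: 'X_[m] :> V.
    case: (posnP (m i)) => [->|mi]; first by rewrite mubr0 !scale0r.
    by rewrite submK // lep1mP -lt0n.
  rewrite -scalerDl mubr_sum -scalerA; congr (_ *: _).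
  rewrite lappD lappN !lappM KE KiE !lappZr KE KiE !scalerA -!qpowD -scalerBl.
  by rewrite -opprD -splitr.
- rewrite lappD !lappM ApE !PE lappZr ApE mnmDUE -scalerDl.
  by rewrite exprS mulN1r addNr scale0r.
- rewrite lappD !lappM AmE !PE !lappZr AmE PE mnmBUE.
  case: (posnP (m i)) => [->|mi].
    by rewrite mubr0 !(scale0r, scaler0) addr0.
  rewrite !scalerA -scalerDl -[X in (-1) ^+ X * _](prednK mi) exprS.
  by rewrite mulN1r mulNr mulrC subrr scale0r.
- by rewrite PE KE !lappZr KE PE !scalerA mulrC.
- by rewrite PE KiE !lappZr KiE PE !scalerA mulrC.
- by rewrite KiE lappZr KE scalerA -qpowD addNr qpow0 scale1r.
- by rewrite KE lappZr KiE scalerA -qpowD subrr qpow0 scale1r.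
- by rewrite PE lappZr PE scalerA -expr2 sqrr_sign scale1r.
Qed.
End Satisfies.

Let gshift i (g : osp_gen) m : 'X_{1..n.+1} :=
  match g with gAp => m + U_(i) | gAm => m - U_(i) | _ => m end%MM.

Let gcoef i (g : osp_gen) (k : nat) : C :=
  match g with
  | gAp => 1
  | gAm => mubr i k
  | gK => qpow h ((gam i + k%:R) / 2)
  | gKi => qpow h (- ((gam i + k%:R) / 2))
  | gP => (-1) ^+ k
  end.

Let act_genE i g m :
  lapp (osp_act_gen i g) 'X_[m] = gcoef i g (m i) *: 'X_[gshift i g m].
Proof.
case: g.
- by rewrite Apact_E scale1r.
- exact: Amact_E.
- exact: Kact_E.
- exact: Kiact_E.
- exact: Pact_E.
Qed.

Let gshift_neq i g m l : i != l -> gshift i g m l = m l.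
Proof.
by move=> /negPf il; case: g;
  rewrite /= ?mnmDE ?mnmBE ?mnm1E ?il ?addn0 ?subn0.
Qed.

Let gshiftC i g l g' m : i != l ->
  gshift i g (gshift l g' m) = gshift l g' (gshift i g m).
Proof.
move=> il; apply/mnmP => k; have li : l != i by rewrite eq_sym.
case: (eqVneq k i) => [->|ki].
  rewrite (gshift_neq _ _ li).
  by case: g; rewrite /= ?mnmDE ?mnmBE (gshift_neq _ _ li).
rewrite eq_sym in ki; rewrite (gshift_neq _ _ ki).
by case: g'; rewrite /= ?mnmDE ?mnmBE (gshift_neq _ _ ki).
Qed.

Lemma osp_act_gen_comm i l g g' : i != l ->
  osp_act_gen i g * osp_act_gen l g' = osp_act_gen l g' * osp_act_gen i g.
Proof.
move=> il; apply: lappE_monom => m; have li : l != i by rewrite eq_sym.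
rewrite !lappM !act_genE !lappZr !act_genE !scalerA.
by rewrite gshiftC // !gshift_neq // mulrC.
Qed.

Lemma osp_act_comm i l (a b : osp h) : i != l ->
  osp_act i a * osp_act l b = osp_act l b * osp_act i a.
Proof.
move=> il; apply: presLift_comm => g'; apply/esym; apply: presLift_comm => g.
by apply/esym/osp_act_gen_comm.
Qed.

Section ActionMorphism.
Hypothesis h1 : `|q| != 1.

Lemma osp_act_morphism i : alg_morphism (osp_act i).
Proof. exact/presLift_morphism/osp_act_satisfies. Qed.

Lemma osp_act_pgen i g : osp_act i (pgen g) = osp_act_gen i g.
Proof. exact: (presLift_gen _ (osp_act_satisfies h1 i)). Qed.

Lemma osp_tact_morphism : alg_morphism osp_tact.
Proof.
apply: tact_morphism => [|i l a b]; [exact: osp_act_morphism|].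
exact: osp_act_comm.
Qed.
End ActionMorphism.

Definition gamsum (j : nat) : R := \sum_(i : 'I_n.+1 | (i < j)%N) gam i.

(* For the operators below, the index i : 'I_n.+1 is the variable x_{i+1}, so *)
(* that [j] is the set of the i < j.                                          *)
Definition Rop (j : nat) i : linEnd V :=
  (\prod_(l : 'I_n.+1 | (l < i)%N) (qpow h (- (gam l / 2)) *: Tq l (- 2^-1))) *
  (\prod_(l : 'I_n.+1 | (i < l < j)%N) (qpow h (gam l / 2) *: Tq l 2^-1 * reflX l)) *
  \prod_(l : 'I_n.+1 | (j <= l)%N) reflX l.

Definition Dop (j : nat) : linEnd V := \sum_(i : 'I_n.+1 | (i < j)%N) Dq i * Rop j i.
Definition Xop (j : nat) : linEnd V := \sum_(i : 'I_n.+1 | (i < j)%N) mulX i * Rop j i.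

(* CK in the variable x_j, j = i + 1, on homogeneous polynomials of degree k. *)
Definition CK i (k : nat) : linEnd V :=
  \sum_(a < k.+1)
    ((-1) ^+ (a * a.+1)./2 * qpow h (a%:R / 2 * (gamsum i.+1 + k%:R - 1)) /
     \prod_(1 <= m < a.+1) mubr i m) *: (mulX i ^+ a * Dop i ^+ a).

(* For js = (j_1, ..., j_n) in the n + 1 variables, and m < n:                *)
(*   psi_arg js 0 = x_1^{j_1},                                                *)
(*   psi_arg js m = X_{[m+1]}^{j_{m+1}} CK_{x_{m+1}} (psi_arg js (m-1)),      *)
(* homogeneous of degree j_1 + ... + j_{m+1}, so psi is CK_{x_{n+1}} of the   *)
(* last of them.                                                              *)
Fixpoint psi_arg (js : seq nat) (m : nat) : V :=
  if m is m'.+1 then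
    lapp (Xop m.+1 ^+ nth 0%N js m)
      (lapp (CK (inord m) (sumn (take m js))) (psi_arg js m'))
  else 'X_ord0 ^+ nth 0%N js 0.

Definition psi (js : n.-tuple nat) : V :=
  lapp (CK ord_max (sumn js)) (psi_arg js n.-1).

Definition CasimirOp (l : nat) : linEnd V :=
  osp_tact (CasimirOn h n.+1 l).

End Realization.

(* Main.v *)
(* The iterated coproduct turns D_[j] and X_[j] into the total actions of A_- *)
(* and A_+ on the first j factors, times the reflections in the remaining     *)
(* variables. As the Casimir element is central, Gamma_[l] then commutes with *)
(* D_[m] and X_[m] for m >= l and with x_m for m > l, hence with every layer  *)
(* of psi outside CK_{x_l}. The image of CK_{x_l} lies in the kernel of       *)
(* D_[l], where the term A_+ A_- of the Casimir element vanishes and what     *)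
(* remains is a scalar on polynomials of fixed degree.                        *)
Require Import Defs.
From HB Require Import structures.
From mathcomp Require Import all_boot all_order all_algebra.
From mathcomp Require Import boolp reals.
From mathcomp Require Import complex mpoly.
From mathcomp Require Import ring.
Set Implicit Arguments.
Unset Strict Implicit.
Unset Printing Implicit Defensive.
Import Order.TTheory GRing.Theory Num.Theory.
Local Open Scope ring_scope.

(** The Casimir operator of the first $\ell$ factors passes unchanged through every layer of [psi]
    outside the extension in $x_\ell$, and it is a scalar on homogeneous monogenics. These two facts
    give the eigenvalue.

    The passage rests on centrality. [Casimir_central] verifies on generators that the Casimir
    element is central. [totactS] describes how the total action of a generator grows by one tensor
    factor on the right. Since a new factor commutes with all earlier ones, centrality persists: the
    Casimir operator of the first factors commutes with the total action on any larger initial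
    segment ([Casimir_tot_comm]). By [Aop_tot] the explicit operators $D_{[j]}$ and $X_{[j]}$ are
    such total actions of $A_-$ and $A_+$, up to reflections in the variables after $x_j$. The
    extension in $x_j$ is a polynomial in $x_j$ and $D_{[j-1]}$, so it is covered too
    ([Casimir_CK_comm]).

    For the scalar, the coefficients of the Cauchy-Kovalevskaya series are those for which $D_{[j]}$
    applied to it telescopes to zero ([CK_monogenic]). On a polynomial killed by $D_{[j]}$ the term
    $A_+A_-$ disappears, and $K$ and $P$ act by scalars that depend only on the degree
    ([Casimir_monogenic]). For $\ell=1$ there is no extension, and the eigenvalue is carried from
    the constant $1$ to $x_1^{j_1}$ by commuting with $x_1$ ([psi_arg_Casimir0]).

    Indices start at $0$: [tot r] and [Cas r] concern the first $r+1$ factors, and the operator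
    [x i] multiplies by $x_{i+1}$. *)

(** * Algebra morphisms and commutation on generators *)

Section AlgMorphism.
Context (K : comNzRingType) (A B : algType K) (f : A -> B).
Hypothesis fP : alg_morphism f.

Lemma alg_morphismD u v : f (u + v) = f u + f v.
Proof. by case: fP => fl _; rewrite -[u in LHS]scale1r fl scale1r. Qed.

Lemma alg_morphism0 : f 0 = 0.
Proof. by apply: (addrI (f 0)); rewrite -alg_morphismD !addr0. Qed.

Lemma alg_morphismZ c u : f (c *: u) = c *: f u.
Proof. by case: fP => fl _; rewrite -[c *: u]addr0 fl alg_morphism0 addr0. Qed.

Lemma alg_morphismN u : f (- u) = - f u.
Proof. by rewrite -scaleN1r alg_morphismZ scaleN1r. Qed.

Lemma alg_morphismM u v : f (u * v) = f u * f v.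
Proof. by case: fP => _ []. Qed.

Lemma alg_morphism1 : f 1 = 1.
Proof. by case: fP => _ []. Qed.
End AlgMorphism.

Lemma alg_morphism_comp (K : comNzRingType) (A B E : algType K)
    (f : A -> B) (g : B -> E) :
  alg_morphism f -> alg_morphism g -> alg_morphism (g \o f).
Proof.
move=> fP gP; split=> [c u v|] /=.
  by rewrite (alg_morphismD fP) (alg_morphismZ fP) (alg_morphismD gP)
    (alg_morphismZ gP).
split=> [|u v] /=; first by rewrite (alg_morphism1 fP) (alg_morphism1 gP).
by rewrite (alg_morphismM fP) (alg_morphismM gP).
Qed.

Section OspMorphism.
Context (R : realType) (h : R[i]) (E : algType R[i]) (f : osp h -> E).
Hypothesis fP : alg_morphism f.

Lemma osp_morphism_comm (z : E) :
  (forall g, z * f (pgen g) = f (pgen g) * z) ->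
  forall u, z * f u = f u * z.
Proof.
move=> zf u; rewrite (presLift_unique fP (fun _ => erefl)).
exact: (presLift_comm zf).
Qed.
End OspMorphism.

Lemma sqr_qcomm (K : comNzRingType) (A : algType K) (s : K) (a k : A) :
  k * a = s *: (a * k) -> k ^+ 2 * a = (s * s) *: (a * k ^+ 2).
Proof.
move=> ka; rewrite !expr2 -mulrA [k * a]ka -scalerAr !mulrA [k * a]ka.
by rewrite -scalerAl scalerA.
Qed.

(** * Centrality of the Casimir element *)

Section AnticommutingCasimir.
Context (S : pzRingType) (a b y : S).

(** The Casimir element has the form $(-ab+y)P$ with $a=A_+$, $b=A_-$. Moving $P$ past $a$ costs a
    sign, so commutation with $a$ becomes this sign-twisted relation, and expanding it gives the
    hypothesis. *)
Lemma anticomm_subr_l : a * (a * b + b * a) = y * a + a * y ->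
  - ((- (a * b) + y) * a) = a * (- (a * b) + y).
Proof.
rewrite mulrDr => e; rewrite mulrDl opprD mulNr opprK mulrDr mulrN.
by apply/eqP; rewrite subr_eq -addrA (addrC (a * y)) -e addKr mulrA.
Qed.

Lemma anticomm_subr_r : (a * b + b * a) * b = y * b + b * y ->
  - ((- (a * b) + y) * b) = b * (- (a * b) + y).
Proof.
rewrite mulrDl => e; rewrite mulrDl opprD mulNr opprK mulrDr mulrN.
apply/eqP; rewrite subr_eq -addrA (addrC (b * y)) -e mulrA.
by rewrite (addrC (a * b * b)) addKr.
Qed.
End AnticommutingCasimir.

Section CasimirCentral.
Context (R : realType) (h : R[i]).
Hypothesis h1 : `|cexp h| != 1.

Lemma qhalf_add_neq0 : qpow h 2^-1 + qpow h (- 2^-1) != 0.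
Proof.
apply: contraNneq (qsub_neq0 h1) => e.
have e1 : cexp h = qpow h 2^-1 * qpow h 2^-1.
  by rewrite -qpowD -qpow1; congr (qpow h _); field.
have e2 : (cexp h)^-1 = qpow h (- 2^-1) * qpow h (- 2^-1).
  by rewrite -qpowD -qpow1 -qpowN; congr (qpow h _); field.
by apply/eqP; rewrite e2 e1 -!expr2 subr_sqr e mulr0.
Qed.

Lemma qhalf_sub_inv : (qpow h 2^-1 - qpow h (- 2^-1))^-1 =
  (cexp h - (cexp h)^-1)^-1 * (qpow h 2^-1 + qpow h (- 2^-1)).
Proof.
have e1 : cexp h = qpow h 2^-1 * qpow h 2^-1.
  by rewrite -qpowD -qpow1; congr (qpow h _); field.
have e2 : (cexp h)^-1 = qpow h (- 2^-1) * qpow h (- 2^-1).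
  by rewrite -qpowD -qpow1 -qpowN; congr (qpow h _); field.
rewrite e2 e1 -!expr2 subr_sqr invfM -mulrA mulVf ?mulr1 //.
exact: qhalf_add_neq0.
Qed.

Let c := (cexp h - (cexp h)^-1)^-1.
Let Y := c *: (qpow h (- 2^-1) *: Kosp h ^+ 2 - qpow h 2^-1 *: Kinv h ^+ 2).

(** From $st=1$ follow $s^2+1=s(s+t)$ and $t^2+1=t(s+t)$, so $s+t$ factors out. For $a=A_\pm$ it
    equals $q^{1/2}+q^{-1/2}$, and [qhalf_sub_inv] turns $c(s+t)$ into the constant in the relation
    for $\{A_+,A_-\}$. *)
Let anticomm_Y s t (a : osp h) : s * t = 1 ->
  Kosp h * a = s *: (a * Kosp h) -> Kinv h * a = t *: (a * Kinv h) ->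
  Y * a + a * Y = (c * (s + t)) *:
    ((qpow h (- 2^-1) * s) *: (a * Kosp h ^+ 2) -
     (qpow h 2^-1 * t) *: (a * Kinv h ^+ 2)).
Proof.
move=> st /sqr_qcomm Ka /sqr_qcomm Kia.
rewrite -scalerAl -scalerAr -scalerDr -[RHS]scalerA; congr (_ *: _).
rewrite mulrBl mulrBr -!scalerAl -!scalerAr Ka Kia addrACA -opprD !scalerA.
rewrite -!scalerDl scalerBr !scalerA; congr (_ *: _ - _ *: _).
  by rewrite mulrDl [X in _ = _ + X]mulrCA (mulrC t) st mulr1 mulrCA.
by rewrite mulrDl [X in _ = X + _]mulrCA st mulr1 addrC mulrCA.
Qed.

Lemma Casimir_comm_Aplus : Casimir h * Aplus h = Aplus h * Casimir h.
Proof.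
have yx := qhalfK h; have xy := yx; rewrite mulrC in xy.
rewrite /Casimir -/c -/Y -mulrA PAplus mulrN mulrA -mulNr mulrA.
congr (_ * _); apply: anticomm_subr_l.
rewrite AplusAminus qhalf_sub_inv (anticomm_Y yx (KAplus h) (KinvAplus h)).
by rewrite xy yx !scale1r -mulrBr -scalerAr.
Qed.

Lemma Casimir_comm_Aminus : Casimir h * Aminus h = Aminus h * Casimir h.
Proof.
have yx := qhalfK h; have xy := yx; rewrite mulrC in xy.
rewrite /Casimir -/c -/Y -mulrA PAminus mulrN mulrA -mulNr mulrA.
congr (_ * _); apply: anticomm_subr_r.
rewrite AplusAminus qhalf_sub_inv (anticomm_Y xy (KAminus h) (KinvAminus h)).
rewrite -scalerAl mulrBl (sqr_qcomm (KAminus h)) (sqr_qcomm (KinvAminus h)).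
by rewrite (addrC (qpow h 2^-1)).
Qed.

Lemma Casimir_comm_Posp : Casimir h * Posp h = Posp h * Casimir h.
Proof.
have PK2 : Posp h * Kosp h ^+ 2 = Kosp h ^+ 2 * Posp h.
  by rewrite !expr2 mulrA PKosp -mulrA PKosp mulrA.
have PKi2 : Posp h * Kinv h ^+ 2 = Kinv h ^+ 2 * Posp h.
  by rewrite !expr2 mulrA PKinv -mulrA PKinv mulrA.
rewrite /Casimir mulrA; congr (_ * _); rewrite mulrDl mulrDr mulrN mulNr.
rewrite -scalerAl -scalerAr mulrBl mulrBr -!scalerAl -!scalerAr PK2 PKi2.
congr (_ + _); rewrite [in RHS]mulrA PAplus mulNr -!mulrA PAminus.
by rewrite mulrN opprK.
Qed.

(** Serves $K$ and $K^{-1}$ alike: the scalars picked up from $A_+$ and $A_-$ cancel in $A_+A_-$. *)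
Let Casimir_comm_diag (s t : R[i]) (k : osp h) : s * t = 1 ->
  k * Aplus h = s *: (Aplus h * k) -> k * Aminus h = t *: (Aminus h * k) ->
  Posp h * k = k * Posp h ->
  Kosp h ^+ 2 * k = k * Kosp h ^+ 2 -> Kinv h ^+ 2 * k = k * Kinv h ^+ 2 ->
  Casimir h * k = k * Casimir h.
Proof.
move=> st kp km kP kK kKi.
rewrite /Casimir -mulrA kP !mulrA; congr (_ * _).
rewrite mulrDl mulrDr mulrN mulNr -scalerAl -scalerAr mulrBl mulrBr.
rewrite -!scalerAl -!scalerAr kK kKi; congr (- _ + _).
by rewrite [RHS]mulrA kp -scalerAl -!mulrA km -scalerAr scalerA st scale1r.
Qed.

Lemma Casimir_central (u : osp h) : Casimir h * u = u * Casimir h.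
Proof.
have idP : alg_morphism (@idfun (osp h)) by [].
apply: (osp_morphism_comm idP) => g.
have yx := qhalfK h; have xy := yx; rewrite mulrC in xy.
case: g.
- exact: Casimir_comm_Aplus.
- exact: Casimir_comm_Aminus.
- apply: (Casimir_comm_diag yx (KAplus h) (KAminus h) (PKosp h)).
    by rewrite -exprSr exprS.
  by rewrite expr2 -mulrA KinvK mulr1 mulrA KKinv mul1r.
- apply: (Casimir_comm_diag xy (KinvAplus h) (KinvAminus h) (PKinv h)).
    by rewrite expr2 -mulrA KKinv mulr1 mulrA KinvK mul1r.
  by rewrite -exprSr exprS.
- exact: Casimir_comm_Posp.
Qed.
End CasimirCentral.

(** * Iterated coproduct and total action on an initial segment of factors *)

Lemma idTens_comp (K : comNzRingType) (A B B' B'' : counitAlgType K)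
    (g : B -> B') (g' : B' -> B'') (gP : alg_morphism g)
    (g'P : alg_morphism g') (t : tens A B) :
  idTens g' (idTens g t) = idTens (g' \o g) t.
Proof.
have ggP := alg_morphism_comp gP g'P.
have P := alg_morphism_comp (idTens_morphism A gP) (idTens_morphism A g'P).
pose F (p : A * B) : tens A B'' := pure p.1 (g' (g p.2)).
rewrite -[LHS]/((idTens g' \o idTens g) t).
rewrite (presLift_unique (f := F) P) => [|[a b]]; last first.
  by rewrite -[pgen _]/(pure a b) /= !idTens_pure.
rewrite -(presLift_unique (f := F) (idTens_morphism A ggP)) => // -[a b].
by rewrite -[pgen _]/(pure a b) /= !idTens_pure.
Qed.

Section TotalAction.
Context (R : realType) (h : R[i]) (E : algType R[i]).

(** The actions [f] of the single factors stay general so that inductions can drop the first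
    factor. *)
Definition totact m (f : 'I_m.+1 -> osp h -> E) r (u : osp h) : E :=
  tact f (tpad m (Deltan r u)).

(** The coproduct is iterated on the last factor, while tensor powers recurse on the first one. This
    form exposes the first factor. *)
Lemma Deltan_Delta r g :
  Deltan r.+1 (pgen g : osp h) = idTens (@Deltan R h r) (Delta_gen h g).
Proof.
have P := Deltan_morphism h.
elim: r => [|r IHr].
  rewrite -[LHS]/(Delta (pgen g)) Delta_pgen.
  have Q := idTens_morphism (osp h) (P 0%N).
  by case: g; rewrite /= ?(alg_morphismD Q) !(idTens_pure (P 0%N)).
rewrite -[LHS]/(idTens (tlast (@Delta R h) (r := r)) (Deltan r.+1 (pgen g))).
by rewrite IHr idTens_comp //; exact: tlast_morphism (Delta_morphism h) r.
Qed.

Section Morphisms.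
Context (m : nat) (f : 'I_m.+1 -> osp h -> E).
Hypothesis fP : forall i, alg_morphism (f i).
Hypothesis fC : forall i j a b, i != j -> f i a * f j b = f j b * f i a.

Lemma totact_morphism r : (r <= m)%N -> alg_morphism (totact f r).
Proof.
move=> rm; have P := alg_morphism_comp (Deltan_morphism h r)
  (tpad_morphism (osp h) rm).
exact: alg_morphism_comp P (tact_morphism fP fC).
Qed.
End Morphisms.

Section Shift.
Context (m : nat) (f : 'I_m.+2 -> osp h -> E).
Hypothesis fP : forall i, alg_morphism (f i).
Hypothesis fC : forall i j a b, i != j -> f i a * f j b = f j b * f i a.
Local Notation f' := (fun i : 'I_m.+1 => f (lift ord0 i)).

Lemma totact0_S u : totact f 0 u = f ord0 u.
Proof.
rewrite -[LHS]/(tact f (pure u (1 : tpow (osp h) m))) (tact_pure fP fC).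
have P : alg_morphism (tact f' : tpow (osp h) m -> E).
  by apply: tact_morphism => // i j a b ij; apply: fC; rewrite (inj_eq lift_inj).
by rewrite (alg_morphism1 P) mulr1.
Qed.

Let totact_pure r (a b : osp h) : (r <= m)%N ->
  tact f (tpad m.+1 (idTens (@Deltan R h r) (pure a b) : tpow (osp h) r.+1)) =
  f ord0 a * totact f' r b.
Proof.
move=> rm; rewrite (idTens_pure (Deltan_morphism h r)).
rewrite -[tpad _ _]/(idTens (@tpad _ (osp h) r m) (pure a (Deltan r b))).
by rewrite (idTens_pure (tpad_morphism (osp h) rm)) (tact_pure fP fC).
Qed.

Lemma totact_shift r g : (r <= m)%N ->
  totact f r.+1 (pgen g) =
  match g with
  | gAp | gAm => f ord0 (pgen g) * totact f' r (Kosp h * Posp h) +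
                 f ord0 (Kinv h) * totact f' r (pgen g)
  | _ => f ord0 (pgen g) * totact f' r (pgen g)
  end.
Proof.
move=> rm; have P : alg_morphism (tact f : tpow (osp h) m.+1 -> E).
  exact: tact_morphism.
have rm1 : (r.+1 <= m.+1)%N by [].
have Q := alg_morphism_comp (tpad_morphism (osp h) rm1) P.
have S := alg_morphism_comp (idTens_morphism (osp h) (Deltan_morphism h r)) Q.
have SD x y : tact f (tpad m.+1 (idTens (@Deltan R h r) (x + y) : tpow (osp h) r.+1)) =
    tact f (tpad m.+1 (idTens (@Deltan R h r) x : tpow (osp h) r.+1)) +
    tact f (tpad m.+1 (idTens (@Deltan R h r) y : tpow (osp h) r.+1)).
  exact: (alg_morphismD S x y).
by rewrite {1}/totact Deltan_Delta; case: g;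
  rewrite /Delta_gen ?SD ?totact_pure.
Qed.
End Shift.

Lemma totact0 m (f : 'I_m.+1 -> osp h -> E) u :
  (forall i, alg_morphism (f i)) ->
  (forall i j a b, i != j -> f i a * f j b = f j b * f i a) ->
  totact f 0 u = f ord0 u.
Proof. by case: m f => [//|m] f fP fC; exact: totact0_S. Qed.

Lemma lift0_inord m r : (r <= m)%N ->
  lift ord0 (inord r : 'I_m.+1) = inord r.+1 :> 'I_m.+2.
Proof. by move=> rm; apply/val_inj; rewrite /= !inordK. Qed.

Let lift_comm m (f : 'I_m.+2 -> osp h -> E) :
  (forall i j a b, i != j -> f i a * f j b = f j b * f i a) ->
  forall (i j : 'I_m.+1) a b, i != j ->
    f (lift ord0 i) a * f (lift ord0 j) b = f (lift ord0 j) b * f (lift ord0 i) a.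
Proof. by move=> fC i j a b ij; apply: fC; rewrite (inj_eq lift_inj). Qed.

Lemma totact_comm m (f : 'I_m.+1 -> osp h -> E) r (z : E) :
  (forall i, alg_morphism (f i)) ->
  (forall i j a b, i != j -> f i a * f j b = f j b * f i a) ->
  (r <= m)%N ->
  (forall i : 'I_m.+1, (i <= r)%N -> forall a, z * f i a = f i a * z) ->
  forall u, z * totact f r u = totact f r u * z.
Proof.
elim: r m f => [|r IHr] m f fP fC rm zf u.
  by rewrite totact0 //; apply: zf.
case: m f fP fC rm zf => // m f fP fC rm zf in u *.
have zT : forall u, z * totact (fun i => f (lift ord0 i)) r u =
    totact (fun i => f (lift ord0 i)) r u * z.
  by apply: IHr => // [|i ir a]; [exact: lift_comm|apply: zf].
have z0 a : z * f ord0 a = f ord0 a * z by apply: zf.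
apply: (osp_morphism_comm (totact_morphism fP fC rm)) => g.
by rewrite (totact_shift fP fC) //; case: g;
  rewrite ?mulrDl ?mulrDr !mulrA !z0 -!mulrA !zT.
Qed.

(** $D_{[j]}$ and $X_{[j]}$ grow by a last variable, so the last factor must be split off. The proof
    opens the first factor by [totact_shift], applies induction to the others, and folds the first
    factor back in. *)
Lemma totactS m (f : 'I_m.+1 -> osp h -> E) r g :
  (forall i, alg_morphism (f i)) ->
  (forall i j a b, i != j -> f i a * f j b = f j b * f i a) ->
  (r < m)%N ->
  totact f r.+1 (pgen g) =
  match g with
  | gAp | gAm => totact f r (pgen g) * f (inord r.+1) (Kosp h * Posp h) +
                 totact f r (Kinv h) * f (inord r.+1) (pgen g)
  | _ => totact f r (pgen g) * f (inord r.+1) (pgen g)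
  end.
Proof.
elim: r m f g => [|r IHr] [//|m] f g fP fC rm.
  rewrite (totact_shift fP fC) // !(totact0 _ fP fC).
  have T0 u : totact (fun i : 'I_m.+1 => f (lift ord0 i)) 0 u = f (inord 1) u.
    rewrite -lift0_inord //.
    have -> : inord 0 = ord0 :> 'I_m.+1 by apply/val_inj; rewrite /= inordK.
    by rewrite totact0 //; exact: lift_comm.
  by case: g; rewrite !T0.
pose f' (i : 'I_m.+1) := f (lift ord0 i).
have f'P i : alg_morphism (f' i) by exact: fP.
have f'C i j a b : i != j -> f' i a * f' j b = f' j b * f' i a.
  exact: lift_comm.
have rm1 : (r < m)%N by [].
have rm' : (r <= m)%N by apply: ltnW.
have P r' (r'm : (r' <= m)%N) : alg_morphism (totact f' r').
  exact: totact_morphism.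
have IH g' := IHr m f' g' f'P f'C rm1.
have fE : f' (inord r.+1) = f (inord r.+2) by rewrite /f' lift0_inord.
have C u v : f (inord r.+2) u * totact f' r v = totact f' r v * f (inord r.+2) u.
  apply: totact_comm => // i ir a; rewrite -fE; apply: f'C.
  by rewrite -val_eqE /= inordK // gtn_eqF.
(* $KP$ is group-like; the two middle operators are exchanged because they live in different tensor
   factors. *)
have KP : totact f' r.+1 (Kosp h * Posp h) =
    totact f' r (Kosp h * Posp h) * f (inord r.+2) (Kosp h * Posp h).
  rewrite (alg_morphismM (P _ rm1)) (alg_morphismM (P _ rm')) (IH gK) (IH gP).
  rewrite fE (alg_morphismM (fP _)) -!/(Kosp h) -!/(Posp h) !mulrA.
  by rewrite -[X in X * _ = _]mulrA C mulrA.
rewrite !(totact_shift fP fC) // -/f' (IH g) KP fE.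
by case: g; rewrite ?mulrDr ?mulrDl ?mulrA -?addrA.
Qed.
End TotalAction.

(** * Absolute values of powers of $q$ *)

Section QPowNorm.
Context (R : realType) (h : R[i]).
Hypothesis h1 : `|cexp h| != 1.

Lemma norm_cexp (z : R[i]) : `|cexp z| = (sequences.expR (complex.Re z))%:C%C.
Proof.
case: z => x y; rewrite normc_def /=; congr (_ %:C)%C.
rewrite !exprMn -mulrDr trigo.cos2Dsin2 mulr1 sqrtr_sqr ger0_norm //.
exact: exp.expR_ge0.
Qed.

(** $|q^a|=e^{a\,\mathrm{Re}\,h}$, and $\mathrm{Re}\,h\neq0$ because $|q|\neq1$. *)
Lemma norm_qpow_neq1 (a : R) : a != 0 -> `|qpow h a| != 1.
Proof.
move=> a0; move: h1; rewrite !norm_cexp /qpow.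
have -> : complex.Re ((a%:C)%C * h) = a * complex.Re h.
  by case: h => x y /=; rewrite mul0r subr0.
have E t : ((sequences.expR t)%:C%C == 1 :> R[i]) = (t == 0).
  by rewrite (inj_eq (@complexI R)) -exp.expR0 (inj_eq (@exp.expR_inj R)).
by rewrite !E mulf_eq0 negb_or a0.
Qed.
End QPowNorm.

Lemma subV_neq0 (F : numFieldType) (z : F) : z != 0 -> `|z| != 1 -> z - z^-1 != 0.
Proof.
move=> z0; apply: contraNneq => /subr0_eq e.
by rewrite -(@pexpr_eq1 _ _ 2) // -normrX expr2 {2}e mulfV // normr1.
Qed.

Lemma addV_neq0 (F : numFieldType) (z : F) : z != 0 -> `|z| != 1 -> z + z^-1 != 0.
Proof.
move=> z0; apply: contraNneq => /eqP; rewrite addr_eq0 => /eqP e.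
by rewrite -(@pexpr_eq1 _ _ 2) // -normrX expr2 {2}e mulrN mulfV // normrN normr1.
Qed.

(** * Initial-segment products, homogeneous polynomials and diagonal operators *)

Section BigOrd.
Context (T : Type) (idx : T) (op : Monoid.com_law idx) (n : nat).

Lemma big_ord_ltS (F : 'I_n.+1 -> T) j : (j <= n)%N ->
  \big[op/idx]_(i : 'I_n.+1 | (i < j.+1)%N) F i =
  op (\big[op/idx]_(i : 'I_n.+1 | (i < j)%N) F i) (F (inord j)).
Proof.
move=> jn; rewrite (bigD1 (inord j)) /= ?inordK //.
rewrite Monoid.mulmC; congr (op _ _); apply: eq_bigl => i.
by rewrite -val_eqE /= inordK // ltnS andbC -ltn_neqAle.
Qed.

Lemma big_ord_geS (F : 'I_n.+1 -> T) j : (j <= n)%N ->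
  \big[op/idx]_(i : 'I_n.+1 | (j <= i)%N) F i =
  op (F (inord j)) (\big[op/idx]_(i : 'I_n.+1 | (j.+1 <= i)%N) F i).
Proof.
move=> jn; rewrite (bigD1 (inord j)) /= ?inordK //.
congr (op _ _); apply: eq_bigl => i.
by rewrite -val_eqE /= inordK // ltn_neqAle andbC eq_sym.
Qed.
End BigOrd.

Section Homogeneous.
Context (K : comNzRingType) (n : nat).
Local Notation V := {mpoly K[n]}.
Implicit Types (p : V) (m : 'X_{1..n}) (F G : linEnd V).

(* The monomials and polynomials of P_k(R^j), as a subspace of P(R^n). *)
Definition hmnm (j k : nat) m := mdeg m = k /\ forall i : 'I_n, (j <= i)%N -> m i = 0%N.
Definition hpoly (j k : nat) p := forall m, p@_m != 0 -> hmnm j k m.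

Lemma hpoly0 j k : hpoly j k 0.
Proof. by move=> m; rewrite mcoeff0 eqxx. Qed.

Lemma hpolyX j k m : hmnm j k m -> hpoly j k 'X_[m].
Proof. by move=> mP m'; rewrite mcoeffX; case: (eqVneq m m') => [<- //|_]; rewrite eqxx. Qed.

Lemma hpolyD j k p p' : hpoly j k p -> hpoly j k p' -> hpoly j k (p + p').
Proof.
move=> pP p'P m; rewrite mcoeffD; have [->|/pP//] := eqVneq (p@_m) 0.
by rewrite add0r => /p'P.
Qed.

Lemma hpolyZ j k c p : hpoly j k p -> hpoly j k (c *: p).
Proof.
move=> pP m; rewrite mcoeffZ; have [->|/pP//] := eqVneq (p@_m) 0.
by rewrite mulr0 eqxx.
Qed.

Lemma hpoly_sum j k (I : Type) (r : seq I) (P : pred I) (f : I -> V) :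
  (forall i, P i -> hpoly j k (f i)) -> hpoly j k (\sum_(i <- r | P i) f i).
Proof. by move=> fP; apply: big_ind => //; [exact: hpoly0|exact: hpolyD]. Qed.

Lemma hpoly_widen j j' k p : (j <= j')%N -> hpoly j k p -> hpoly j' k p.
Proof.
move=> jj' pP m /pP [mk m0]; split=> // i j'i; apply: m0.
exact: leq_trans jj' j'i.
Qed.

Lemma lapp_mpolyE F p : lapp F p = \sum_(m <- msupp p) p@_m *: lapp F 'X_[m].
Proof.
rewrite {1}[p]mpolyE /lapp linear_sum /=.
by apply: eq_bigr => m _; rewrite linearZ.
Qed.

Lemma hpoly_lapp j k j' k' F p :
  (forall m, hmnm j k m -> hpoly j' k' (lapp F 'X_[m])) ->
  hpoly j k p -> hpoly j' k' (lapp F p).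
Proof.
move=> FP pP; rewrite lapp_mpolyE big_seq; apply: hpoly_sum => m pm.
by apply/hpolyZ/FP/pP; rewrite -mcoeff_msupp.
Qed.

Lemma hpoly_eq j k F G p :
  (forall m, hmnm j k m -> lapp F 'X_[m] = lapp G 'X_[m]) ->
  hpoly j k p -> lapp F p = lapp G p.
Proof.
move=> FG pP; rewrite !lapp_mpolyE !big_seq; apply: eq_bigr => m pm.
by rewrite FG //; apply: pP; rewrite -mcoeff_msupp.
Qed.

Lemma hpoly_scale j k F c p :
  (forall m, hmnm j k m -> lapp F 'X_[m] = c *: 'X_[m]) ->
  hpoly j k p -> lapp F p = c *: p.
Proof. by move=> Fc pP; rewrite (hpoly_eq (G := c *: 1) _ pP). Qed.

Lemma hmnm_sum j k m : hmnm j k m -> (\sum_(i < n | (i < j)%N) m i)%N = k.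
Proof.
move=> [<- m0]; rewrite mdegE [RHS](bigID (fun i : 'I_n => (i < j)%N)) /=.
by rewrite [X in _ = (_ + X)%N]big1 ?addn0 // => i; rewrite -leqNgt => /m0.
Qed.
End Homogeneous.

Section Diagonal.
Context (K : comNzRingType) (n : nat).
Local Notation V := {mpoly K[n]}.

(** $K^{\pm1}$, $P$ and the strings $R_{[j],i}$ all scale monomials. Identities between them reduce
    to identities between scalars, and they commute with each other. *)
Definition diagop (d : 'X_{1..n} -> K) (F : linEnd V) :=
  forall m, lapp F 'X_[m] = d m *: 'X_[m].

Lemma diagop_eq d d' F G :
  diagop d F -> diagop d' G -> d =1 d' -> F = G.
Proof.
move=> Fd Gd dd; apply/linEndP => p; rewrite !lapp_mpolyE.
by apply: eq_bigr => m _; rewrite Fd Gd dd.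
Qed.

Lemma diagopM d d' F G :
  diagop d F -> diagop d' G -> diagop (fun m => d m * d' m) (F * G).
Proof. by move=> Fd Gd m; rewrite lappM Gd lappZr Fd scalerA mulrC. Qed.

Lemma diagopC d d' F G : diagop d F -> diagop d' G -> F * G = G * F.
Proof.
move=> Fd Gd; apply: (diagop_eq (diagopM Fd Gd) (diagopM Gd Fd)) => m.
by rewrite mulrC.
Qed.

Lemma diagop_prod (I : Type) (r : seq I) (P : pred I) d (F : I -> linEnd V) :
  (forall i, diagop (d i) (F i)) ->
  diagop (fun m => \prod_(i <- r | P i) d i m) (\prod_(i <- r | P i) F i).
Proof.
move=> Fd; elim: r => [|i r IHr] m; first by rewrite !big_nil lapp1 scale1r.
by rewrite !big_cons; case: (P i); [exact: (diagopM (Fd i) IHr m)|exact: IHr].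
Qed.
End Diagonal.

(** * $D_{[j]}$ and $X_{[j]}$ as total actions of $A_-$ and $A_+$ *)

Section Operators.
Context (R : realType) (h : R[i]) (n : nat) (mu : 'I_n.+1 -> R).
Hypothesis h1 : `|cexp h| != 1.
Local Notation C := R[i].
Local Notation V := {mpoly C[n.+1]}.
Local Notation act := (osp_act_gen h mu).
Local Notation tot := (totact (@osp_act R h n mu)).
Local Notation W j := (\prod_(l : 'I_n.+1 | (j <= l)%N) @reflX R n l : linEnd V).
Implicit Types (i l : 'I_n.+1) (m : 'X_{1..n.+1}) (p : V).

Let aP : forall i, alg_morphism (@osp_act R h n mu i) := osp_act_morphism mu h1.
Let aC : forall i l (a b : osp h), i != l ->
  osp_act mu i a * osp_act mu l b = osp_act mu l b * osp_act mu i a :> linEnd V.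
Proof. by move=> i l a b; exact: osp_act_comm. Qed.

Lemma tot_morphism r : (r <= n)%N -> alg_morphism (tot r).
Proof. exact: totact_morphism aP aC r. Qed.

Lemma tot0 g : tot 0 (pgen g) = act ord0 g.
Proof. by rewrite totact0 // osp_act_pgen. Qed.

Lemma totS r g : (r < n)%N -> tot r.+1 (pgen g) =
  match g with
  | gAp | gAm =>
      tot r (pgen g) * (act (inord r.+1) gK * act (inord r.+1) gP) +
      tot r (pgen gKi) * act (inord r.+1) g
  | _ => tot r (pgen g) * act (inord r.+1) g
  end.
Proof.
move=> rn; rewrite (totactS _ aP aC rn) (alg_morphismM (aP _)).
by rewrite !osp_act_pgen.
Qed.

Lemma act_tot_comm r i (a u : osp h) : (r < i)%N ->
  osp_act mu i a * tot r u = tot r u * osp_act mu i a.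
Proof.
move=> ri; apply: totact_comm => // [|l lr b].
  by apply: leq_trans (ltnW ri) _; rewrite -ltnS.
by apply: aC; rewrite -val_eqE gtn_eqF // (leq_ltn_trans lr).
Qed.

(** $K$, $K^{-1}$ and $P$ are group-like, so their eigenvalues multiply over the factors. *)
Lemma tot_diag r (d : osp_gen -> 'I_n.+1 -> 'X_{1..n.+1} -> C) g :
  (r <= n)%N -> (if g is (gAp | gAm) then False else True) ->
  (forall i, diagop (d g i) (act i g)) ->
  diagop (fun m => \prod_(i : 'I_n.+1 | (i < r.+1)%N) d g i m) (tot r (pgen g)).
Proof.
move=> rn gd dg; elim: r rn => [|r IHr] rn m.
  rewrite tot0 dg; congr (_ *: _); rewrite (big_pred1 ord0) // => i.
  by rewrite ltnS leqn0.
rewrite big_ord_ltS // totS //.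
by case: g gd dg IHr => // _ dg IHr; exact: (diagopM (IHr (ltnW rn)) (dg _) m).
Qed.

Lemma prod_qpow (P : pred 'I_n.+1) (F : 'I_n.+1 -> R) :
  \prod_(i | P i) qpow h (F i) = qpow h (\sum_(i | P i) F i).
Proof.
by rewrite (big_morph (qpow h) (qpowD h) (qpow0 h)).
Qed.

Lemma tot_KE r k m : (r <= n)%N -> hmnm r.+1 k m ->
  lapp (tot r (Kosp h)) 'X_[m] = qpow h ((gamsum mu r.+1 + k%:R) / 2) *: 'X_[m].
Proof.
move=> rn /hmnm_sum <-.
rewrite (@tot_diag r (fun _ i m => qpow h ((gam mu i + (m i)%:R) / 2)) gK) //; last first.
  by move=> i m'; rewrite Kact_E.
by rewrite prod_qpow -mulr_suml big_split /= natr_sum.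
Qed.

Lemma tot_KiE r k m : (r <= n)%N -> hmnm r.+1 k m ->
  lapp (tot r (Kinv h)) 'X_[m] = qpow h (- ((gamsum mu r.+1 + k%:R) / 2)) *: 'X_[m].
Proof.
move=> rn /hmnm_sum <-.
rewrite (@tot_diag r (fun _ i m => qpow h (- ((gam mu i + (m i)%:R) / 2))) gKi) //; last first.
  by move=> i m'; rewrite Kiact_E.
by rewrite prod_qpow sumrN -mulr_suml big_split /= natr_sum.
Qed.

Lemma tot_PE r k m : (r <= n)%N -> hmnm r.+1 k m ->
  lapp (tot r (Posp h)) 'X_[m] = (-1) ^+ k *: 'X_[m].
Proof.
move=> rn /hmnm_sum <-.
rewrite (@tot_diag r (fun _ i m => (-1) ^+ (m i)) gP) //; last first.
  by move=> i m'; rewrite Pact_E.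
by rewrite prodrXr.
Qed.

Lemma W_diag j : diagop (fun m => \prod_(l : 'I_n.+1 | (j <= l)%N) (-1) ^+ m l : C) (W j).
Proof. by apply: diagop_prod => l m; exact: substXE. Qed.

Lemma W_hpoly j k p : hpoly j k p -> lapp (W j) p = p.
Proof.
move=> pP; rewrite -[RHS]scale1r; apply: hpoly_scale pP => m [_ m0].
rewrite W_diag; congr (_ *: _); apply: big1 => l jl.
by rewrite m0 // expr0.
Qed.

Lemma W_rec j : (j <= n)%N -> W j = reflX R (inord j) * W j.+1.
Proof.
move=> jn; apply: (diagop_eq (@W_diag j)).
  apply: diagopM (@W_diag j.+1); exact: (substXE (inord j) (-1)).
by move=> m; rewrite big_ord_geS.
Qed.

Lemma W_comm j (z : linEnd V) :
  (forall l, (j <= l)%N -> z * reflX R l = reflX R l * z) -> z * W j = W j * z.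
Proof. by move=> zr; apply: commr_prod. Qed.

(* Dop and Xop are the cases g = gAm and g = gAp. *)
Definition Aop g (j : nat) : linEnd V :=
  \sum_(i : 'I_n.+1 | (i < j)%N) act i g * Rop h mu j i.

Let A l m : C := qpow h (- ((gam mu l + (m l)%:R) / 2)).
Let B l m : C := qpow h ((gam mu l + (m l)%:R) / 2) * (-1) ^+ m l.
Let S l m : C := (-1) ^+ m l.

Lemma Rop_diag j i : diagop (fun m =>
  (\prod_(l : 'I_n.+1 | (l < i)%N) A l m) *
  (\prod_(l : 'I_n.+1 | (i < l < j)%N) B l m) *
  (\prod_(l : 'I_n.+1 | (j <= l)%N) S l m)) (Rop h mu j i).
Proof.
apply: diagopM (@W_diag j); apply: diagopM; apply: diagop_prod => l m.
  exact: (Kiact_E h mu l).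
exact: (diagopM (Kact_E h mu l) (Pact_E h mu l) m).
Qed.

(** When [j] grows by one, the reflection of index [j] moves from the tail product into the middle
    one, where it joins a $K$. Only that $K$ is new. *)
Lemma Rop_rec j i : (i < j <= n)%N -> Rop h mu j.+1 i = Rop h mu j i * act (inord j) gK.
Proof.
move=> /andP[ij jn]; apply: (diagop_eq (@Rop_diag _ _)).
  exact: diagopM (@Rop_diag _ _) (Kact_E h mu (inord j)).
move=> m; rewrite -!mulrA; congr (_ * _).
rewrite [X in X * _ = _](bigD1 (inord j)) /= ?inordK ?ij ?ltnSn //.
rewrite [X in _ = _ * (X * _)]big_ord_geS //.
rewrite (eq_bigl (fun l : 'I_n.+1 => (i < l < j)%N)) => [|l].
  rewrite /B /S /=. ring.
rewrite -val_eqE /= inordK // -andbA; congr (_ && _).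
by rewrite ltnS andbC -ltn_neqAle.
Qed.

Lemma Rop_last r : (r < n)%N ->
  Rop h mu r.+2 (inord r.+1) = tot r (pgen gKi) * W r.+2.
Proof.
move=> rn; apply: (diagop_eq (@Rop_diag _ _)).
  apply: diagopM (@W_diag r.+2).
  exact: (@tot_diag r (fun _ => A) gKi (ltnW rn) I (Kiact_E h mu)).
move=> m; rewrite /= inordK // [X in _ * X * _]big_pred0 ?mulr1 // => l.
by rewrite ltnS ltnNge andNb.
Qed.

Lemma Aop_rec g j : (j <= n)%N ->
  Aop g j.+1 = Aop g j * act (inord j) gK + act (inord j) g * Rop h mu j.+1 (inord j).
Proof.
move=> jn; rewrite /Aop big_ord_ltS // mulr_suml; congr (_ + _).
by apply: eq_bigr => i ij; rewrite Rop_rec ?ij // mulrA.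
Qed.

(** [Aop_rec] has the two summands of the coproduct of $A_\pm$, so it matches [totS] term by
    term. *)
Lemma Aop_tot g r : (r <= n)%N -> (if g is (gAp | gAm) then True else False) ->
  Aop g r.+1 = tot r (pgen g) * W r.+1.
Proof.
move=> + gA; elim: r => [|r IHr] rn.
  rewrite Aop_rec // /Aop big_pred0 // mul0r add0r tot0.
  have -> : inord 0 = ord0 :> 'I_n.+1 by apply/val_inj; rewrite /= inordK.
  congr (_ * _); apply: (diagop_eq (@Rop_diag _ _) (@W_diag 1%N)) => m.
  rewrite big_pred0 // mul1r big_pred0 ?mul1r // => l /=.
  by case: (nat_of_ord l) => [|[|?]].
have E : tot r.+1 (pgen g) = tot r (pgen g) * (act (inord r.+1) gK * act (inord r.+1) gP) +
      tot r (pgen gKi) * act (inord r.+1) g.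
  by rewrite totS //; case: g gA {IHr}.
have KW : act (inord r.+1) gK * W r.+2 = W r.+2 * act (inord r.+1) gK.
  exact: diagopC (Kact_E h mu _) (@W_diag _).
have PK : act (inord r.+1) gK * act (inord r.+1) gP =
    act (inord r.+1) gP * act (inord r.+1) gK.
  exact: diagopC (Kact_E h mu _) (Pact_E h mu _).
(* [W r.+1] contains the reflection of index [r.+1], which completes $K$ to $KP$ in the first
   summand. *)
rewrite Aop_rec // (IHr (ltnW rn)) Rop_last // E mulrDl W_rec //; congr (_ + _).
  by rewrite PK -!mulrA KW.
rewrite !mulrA; congr (_ * _); rewrite -!osp_act_pgen //.
by rewrite act_tot_comm // inordK.
Qed.
End Operators.

Lemma lapp_sum (K : comNzRingType) (V : lalgType K) (I : Type) (r : seq I)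
    (P : pred I) (F : I -> linEnd V) p :
  lapp (\sum_(i <- r | P i) F i) p = \sum_(i <- r | P i) lapp (F i) p.
Proof. exact: (big_morph (fun f => lapp f p) (fun f g => lappD f g p) (lapp0 p)). Qed.

Lemma lapp_sumr (K : comNzRingType) (V : lalgType K) (I : Type) (r : seq I)
    (P : pred I) (f : linEnd V) (F : I -> V) :
  lapp f (\sum_(i <- r | P i) F i) = \sum_(i <- r | P i) lapp f (F i).
Proof. exact: linear_sum. Qed.

(** * Monogenics and the Cauchy-Kovalevskaya extension *)

Section Monogenics.
Context (R : realType) (h : R[i]) (n : nat) (mu : 'I_n.+1 -> R).
Hypothesis h1 : `|cexp h| != 1.
Local Notation C := R[i].
Local Notation V := {mpoly C[n.+1]}.
Local Notation act := (osp_act_gen h mu).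
Local Notation tot := (totact (@osp_act R h n mu)).
Local Notation W j := (\prod_(l : 'I_n.+1 | (j <= l)%N) @reflX R n l : linEnd V).
Local Notation x i := (@mulX R n i).
Local Notation Dop := (Dop h mu).
Local Notation Xop := (Xop h mu).
Implicit Types (i l : 'I_n.+1) (m : 'X_{1..n.+1}) (p f : V).

Lemma Dop_tot r : (r <= n)%N -> Dop r.+1 = tot r (Aminus h) * W r.+1.
Proof. by move=> rn; exact: (Aop_tot (g := gAm) mu h1 rn I). Qed.

Lemma Xop_tot r : (r <= n)%N -> Xop r.+1 = tot r (Aplus h) * W r.+1.
Proof. by move=> rn; exact: (Aop_tot (g := gAp) mu h1 rn I). Qed.

(** The variable of index [i] lies outside the total action in [Dop i]. Only its reflection, a
    factor of [W i], fails to commute with it, and contributes the sign. *)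
Lemma mulX_Dop_anticomm i : (0 < i)%N -> x i * Dop i = - (Dop i * x i).
Proof.
case: i => -[//|r] ri /= _; have rn : (r < n)%N by [].
have -> : Ordinal ri = inord r.+1 by apply/val_inj; rewrite /= inordK.
set i := inord r.+1; have iE : i = r.+1 :> nat by rewrite inordK.
have xE : x i = osp_act mu i (Aplus h) by rewrite osp_act_pgen.
rewrite (Dop_tot (ltnW rn)) (W_rec R rn) -/i mulrA {1}xE act_tot_comm ?iE //.
rewrite -xE.
rewrite -!mulrA -mulrN; congr (_ * _).
have -> : W r.+2 * x i = x i * W r.+2.
  apply/esym/W_comm => l rl.
  apply: (osp_act_gen_comm h mu gAp gP).
  by rewrite -val_eqE /= iE ltn_eqF.
rewrite !mulrA -mulNr; congr (_ * _).
have := PAplus h => /(congr1 (@osp_act R h n mu i)).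
rewrite (alg_morphismN (osp_act_morphism mu h1 i)) !(alg_morphismM (osp_act_morphism mu h1 i)).
by rewrite !osp_act_pgen // => ->; rewrite opprK.
Qed.

Lemma Dop_mulX_exp i a : (0 < i)%N ->
  Dop i * x i ^+ a = (-1) ^+ a *: (x i ^+ a * Dop i).
Proof.
move=> i0; elim: a => [|a IHa]; first by rewrite !expr0 scale1r mul1r mulr1.
have E : Dop i * x i = - (x i * Dop i) by rewrite mulX_Dop_anticomm // opprK.
rewrite exprSr mulrA IHa -scalerAl -!mulrA E mulrN scalerN.
by rewrite (exprS (-1)) mulN1r scaleNr.
Qed.

Lemma hmnmDU j k i m : (i < j)%N -> hmnm j k m -> hmnm j k.+1 (m + U_(i))%MM.
Proof.
move=> ij [<- m0]; split; first by rewrite mdegD mdeg1 addn1.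
move=> l jl; rewrite mnmDE mnm1E m0 // add0n; case: eqP => // il.
by move: jl; rewrite -il leqNgt ij.
Qed.

Lemma hmnmBU j k i m : (0 < m i)%N -> hmnm j k.+1 m -> hmnm j k (m - U_(i))%MM.
Proof.
move=> mi [mk m0]; split; last by move=> l jl; rewrite mnmBE m0.
have mE : (m - U_(i) + U_(i))%MM = m by rewrite submK // lep1mP -lt0n.
by apply/eqP; rewrite -eqSS -mk -[X in _ == mdeg X]mE mdegD mdeg1 addn1.
Qed.

Lemma mulX_hpoly j k i p : (i < j)%N -> hpoly j k p -> hpoly j k.+1 (lapp (x i) p).
Proof.
by move=> ij; apply: hpoly_lapp => m mP; rewrite mulXE; apply/hpolyX/hmnmDU.
Qed.

Lemma mulX_exp_hpoly j k i a p :
  (i < j)%N -> hpoly j k p -> hpoly j (a + k) (lapp (x i ^+ a) p).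
Proof.
move=> ij pP; elim: a => [//|a IHa].
by rewrite exprS lappM addSn; exact: mulX_hpoly.
Qed.

Lemma Xop_hpoly j k p : hpoly j k p -> hpoly j k.+1 (lapp (Xop j) p).
Proof.
apply: hpoly_lapp => m mP; rewrite /Defs.Xop lapp_sum; apply: hpoly_sum => i ij.
rewrite lappM (Rop_diag h mu) lappZr; apply: hpolyZ.
by rewrite mulXE; apply/hpolyX/hmnmDU.
Qed.

Lemma Xop_exp_hpoly j k a p : hpoly j k p -> hpoly j (k + a) (lapp (Xop j ^+ a) p).
Proof.
move=> pP; elim: a => [|a IHa]; first by rewrite addn0.
by rewrite exprS lappM addnS; exact: Xop_hpoly.
Qed.

Lemma Dop_hpoly j k p : hpoly j k.+1 p -> hpoly j k (lapp (Dop j) p).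
Proof.
apply: hpoly_lapp => m mP; rewrite /Defs.Dop lapp_sum; apply: hpoly_sum => i ij.
rewrite lappM (Rop_diag h mu) lappZr DqE; apply/hpolyZ.
case: (posnP (m i)) => [->|mi]; first by rewrite mubr0 scale0r; exact: hpoly0.
exact/hpolyZ/hpolyX/hmnmBU.
Qed.

Lemma Dop_hpoly0 j p : hpoly j 0 p -> lapp (Dop j) p = 0.
Proof.
move=> pP; rewrite -[RHS](lapp0 p); apply: hpoly_eq pP => m [md _].
rewrite /Defs.Dop lapp_sum big1 // => i ij.
rewrite lappM (Rop_diag h mu) lappZr DqE.
have -> : m i = 0%N by move/eqP: md; rewrite mdeg_eq0 => /eqP->; rewrite mnm0E.
by rewrite mubr0 scale0r scaler0.
Qed.

Lemma Dop_exp_hpoly j k a p : (a <= k)%N ->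
  hpoly j k p -> hpoly j (k - a) (lapp (Dop j ^+ a) p).
Proof.
move=> ak pP; elim: a ak => [|a IHa] ak; first by rewrite subn0.
rewrite exprS lappM; apply: Dop_hpoly; rewrite -subSn // subSS.
exact/IHa/ltnW.
Qed.

Lemma Dop_exp_hpoly0 j k p : hpoly j k p -> lapp (Dop j ^+ k.+1) p = 0.
Proof.
move=> pP; rewrite exprS lappM; apply: Dop_hpoly0.
by rewrite -(subnn k); apply: Dop_exp_hpoly.
Qed.

Lemma CK_hpoly i k p : hpoly i k p -> hpoly i.+1 k (lapp (CK h mu i k) p).
Proof.
move=> pP; rewrite /CK lapp_sum; apply: hpoly_sum => a _.
rewrite lappZ lappM; apply: hpolyZ.
have ak : (a <= k)%N by rewrite -ltnS.
rewrite -[k in hpoly _ k](subnKC ak); apply: mulX_exp_hpoly => //.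
by apply: (hpoly_widen (leqnSn i)); apply: Dop_exp_hpoly.
Qed.

Lemma mulX_expE i a m : lapp (x i ^+ a) 'X_[m] = 'X_[m + U_(i) *+ a].
Proof.
elim: a m => [|a IHa] m; first by rewrite mulm0n addm0.
by rewrite exprSr lappM mulXE IHa mulmS addmA.
Qed.

Lemma mnm_mulX i a k m : hmnm i k m -> (m + U_(i) *+ a)%MM i = a.
Proof. by case=> _ m0; rewrite mnmDE mulmnE mnm1E eqxx mul1n m0. Qed.

Lemma K_mulX_exp i a k p : hpoly i k p ->
  lapp (act i gK) (lapp (x i ^+ a) p) =
  qpow h ((gam mu i + a%:R) / 2) *: lapp (x i ^+ a) p.
Proof.
apply: (hpoly_eq (F := act i gK * x i ^+ a) (G := _ *: x i ^+ a)) => m mP.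
by rewrite [LHS]lappM [RHS]lappZ !mulX_expE Kact_E (mnm_mulX _ mP).
Qed.

Lemma Dq_mulX_exp i a k p : hpoly i k p ->
  lapp (Dq h mu i) (lapp (x i ^+ a.+1) p) = mubr h mu i a.+1 *: lapp (x i ^+ a) p.
Proof.
apply: (hpoly_eq (F := Dq h mu i * x i ^+ a.+1) (G := _ *: x i ^+ a)) => m mP.
rewrite [LHS]lappM [RHS]lappZ !mulX_expE DqE (mnm_mulX _ mP).
by rewrite mulmS (addmC U_(i)%MM) addmA addmK.
Qed.

Lemma Dq_hpoly i k p : hpoly i k p -> lapp (Dq h mu i) p = 0.
Proof.
move=> pP; rewrite -[RHS](lapp0 p); apply: hpoly_eq pP => m [_ m0].
by rewrite DqE m0 // mubr0 scale0r.
Qed.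

Lemma Rop_mulX_exp i a k p : (0 < i)%N -> hpoly i k p ->
  lapp (Rop h mu i.+1 i) (lapp (x i ^+ a) p) =
  qpow h (- ((gamsum mu i + k%:R) / 2)) *: lapp (x i ^+ a) p.
Proof.
case: i => -[//|r] ri /= _; have rn : (r < n)%N by [].
have -> : Ordinal ri = inord r.+1 by apply/val_inj; rewrite /= inordK.
set i := inord r.+1; have iE : i = r.+1 :> nat by rewrite inordK.
move=> pP; rewrite Rop_last // lappM.
have pP' : hpoly r.+2 k p by apply: hpoly_widen pP.
rewrite (W_hpoly (mulX_exp_hpoly (i := i) (a := a) _ pP')) ?iE // -lappM.
have -> : tot r (pgen gKi) * x i ^+ a = x i ^+ a * tot r (pgen gKi).
  apply: commrX; have -> : x i = osp_act mu i (Aplus h) by rewrite osp_act_pgen.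
  by rewrite /GRing.comm act_tot_comm // iE.
rewrite lappM -lappZr; congr lapp.
by apply: hpoly_scale pP => m; exact: tot_KiE (ltnW rn).
Qed.

(** With $A=q^{\mu+k/2}$ and $B=q^{k/2}$ the numerator factors as $(A-A^{-1})(B+B^{-1})$ for odd $k$
    and $(A+A^{-1})(B-B^{-1})$ for even $k$. No factor vanishes, since $|A|$ and $|B|$ differ from
    $1$. *)
Lemma mubr_neq0 i k : 0 < mu i -> (0 < k)%N -> mubr h mu i k != 0.
Proof.
move=> mu0 k0; set A := qpow h (mu i + k%:R / 2); set B := qpow h (k%:R / 2).
have kr : 0 < k%:R / 2 :> R by rewrite divr_gt0 ?ltr0n.
have A0 : A != 0 by exact: qpow_neq0.
have B0 : B != 0 by exact: qpow_neq0.
have A1 : `|A| != 1 by rewrite norm_qpow_neq1 // gt_eqF // addr_gt0.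
have B1 : `|B| != 1 by rewrite norm_qpow_neq1 // gt_eqF.
have E1 : qpow h (mu i + k%:R) = A * B.
  by rewrite -qpowD; congr (qpow h _); field.
have E2 : qpow h (mu i) = A * B^-1.
  by rewrite -qpowN -qpowD; congr (qpow h _); field.
rewrite /mubr /qnum !qpowN E1 E2 mulrA -mulrBl mulf_neq0 ?invr_neq0 ?qsub_neq0 //.
rewrite !invfM invrK -signr_odd; case: (odd k) => /=.
  rewrite (_ : _ - _ = (A - A^-1) * (B + B^-1)); last by ring.
  by rewrite mulf_neq0 ?subV_neq0 ?addV_neq0.
rewrite (_ : _ - _ = (A + A^-1) * (B - B^-1)); last by ring.
by rewrite mulf_neq0 ?subV_neq0 ?addV_neq0.
Qed.

Definition CKcoef i k a : C :=
  (-1) ^+ (a * a.+1)./2 * qpow h (a%:R / 2 * (gamsum mu i.+1 + k%:R - 1)) /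
  \prod_(1 <= m < a.+1) mubr h mu i m.

(** The recursion behind the telescoping. Its sign comes from $(a+1)(a+2)/2=(a+1)+a(a+1)/2$. *)
Lemma CKcoefS i k a : 0 < mu i ->
  CKcoef i k a.+1 * mubr h mu i a.+1 =
  (-1) ^+ a.+1 * qpow h ((gamsum mu i.+1 + k%:R - 1) / 2) * CKcoef i k a.
Proof.
move=> mu0; rewrite /CKcoef big_nat_recr // invfM.
have -> : ((a.+1 * a.+2)./2 = a.+1 + (a * a.+1)./2)%N.
  have -> : (a.+1 * a.+2 = a.+1.*2 + a * a.+1)%N by rewrite -muln2; ring.
  by rewrite halfD odd_double /= doubleK.
have -> : a.+1%:R / 2 * (gamsum mu i.+1 + k%:R - 1) =
    (gamsum mu i.+1 + k%:R - 1) / 2 + a%:R / 2 * (gamsum mu i.+1 + k%:R - 1).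
  by rewrite -natr1; field.
have m0 := mubr_neq0 mu0 (ltn0Sn a).
rewrite exprD qpowD -!mulrA mulVf // mulr1.
by ring.
Qed.

Lemma gamsum_rec i : gamsum mu i.+1 = gamsum mu i + gam mu i.
Proof. by rewrite /gamsum big_ord_ltS ?inord_val // -ltnS. Qed.

(** [Aop_rec] splits [Dop i.+1] into [Dop i] after $K$ and [Dq] after [Rop]. On the term of index
    $a$ the first part raises the power of [Dop i] on [p], and the second lowers the power of the
    new variable. Each first part cancels the second part of the next term. *)
Lemma CK_monogenic i k p : (0 < i)%N -> 0 < mu i -> hpoly i k p ->
  lapp (Dop i.+1) (lapp (CK h mu i k) p) = 0.
Proof.
move=> i0 mu0 pP.
have DE v : lapp (Dop i.+1) v = lapp (Dop i) (lapp (act i gK) v) +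
    lapp (Dq h mu i) (lapp (Rop h mu i.+1 i) v).
  have := @Aop_rec R h n mu gAm i (ltn_ord i); rewrite inord_val => E.
  by rewrite -[Dop i.+1]/(Aop h mu gAm i.+1) E.
have Dx a v : lapp (Dop i) (lapp (x i ^+ a) v) = (-1) ^+ a *: lapp (x i ^+ a) (lapp (Dop i) v).
  by rewrite -!lappM Dop_mulX_exp.
pose g a := lapp (Dop i ^+ a) p.
have gP a : (a <= k)%N -> hpoly i (k - a) (g a) by move=> ak; exact: Dop_exp_hpoly.
pose s a : V := ((-1) ^+ a * CKcoef i k a * qpow h ((gam mu i + a%:R) / 2)) *:
  lapp (x i ^+ a) (g a.+1).
pose t a : V := (CKcoef i k a * qpow h (- ((gamsum mu i + (k - a)%:R) / 2))) *:
  lapp (Dq h mu i) (lapp (x i ^+ a) (g a)).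
transitivity (\sum_(a < k.+1) (s a + t a)).
  rewrite [lapp (CK _ _ _ _) p]lapp_sum lapp_sumr; apply: eq_bigr => a _.
  have ak : (a <= k)%N by rewrite -ltnS.
  rewrite -/(CKcoef i k a) lappZ lappZr lappM -/(g a) DE.
  rewrite (K_mulX_exp _ (gP _ ak)) lappZr Dx (Rop_mulX_exp _ i0 (gP _ ak)) lappZr.
  rewrite scalerDr !scalerA /s /t /g exprS lappM; congr (_ *: _ + _).
  by rewrite mulrC -mulrA mulrC.
(* Detach the two unpaired ends, so that [s a] meets [t a.+1]. The end [s k] vanishes since
   [Dop i ^+ k.+1] kills degree [k], and [t 0] since [p] does not involve the new variable. *)
rewrite big_split /= big_ord_recr big_ord_recl /=.
have -> : s k = 0 by rewrite /s /g (Dop_exp_hpoly0 pP) /lapp linear0 scaler0.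
have -> : t 0%N = 0.
  by rewrite /t expr0 lapp1 (Dq_hpoly (gP 0%N _)) // scaler0.
rewrite addr0 add0r -big_split big1 //= => a _; rewrite /bump /= add1n.
rewrite /s /t (Dq_mulX_exp _ (gP _ _)) // scalerA -scalerDl.
rewrite (mulrAC _ _ (mubr _ _ _ _)) CKcoefS // gamsum_rec.
apply/eqP; rewrite scaler_eq0; apply/orP; left; apply/eqP.
(* The exponent in the recursion is the one from $K$ in [s a] plus the one from [Rop] in [t a.+1],
   up to the sign of the latter. *)
have -> : (gamsum mu i + gam mu i + k%:R - 1) / 2 =
  (gam mu i + a%:R) / 2 + (gamsum mu i + (k - a.+1)%:R) / 2.
  by rewrite natrB // -natr1; field.
rewrite qpowD qpowN exprS.
have := qpow_neq0 h ((gamsum mu i + (k - a.+1)%:R) / 2).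
by move: (qpow _ _) => z z0; field.
Qed.
End Monogenics.

(** * Commutation properties and eigenvalue of the Casimir operators *)

Section CasimirAction.
Context (R : realType) (h : R[i]) (n : nat) (mu : 'I_n.+1 -> R).
Hypothesis h1 : `|cexp h| != 1.
Local Notation C := R[i].
Local Notation V := {mpoly C[n.+1]}.
Local Notation act := (osp_act_gen h mu).
Local Notation tot := (totact (@osp_act R h n mu)).
Local Notation Dop := (Dop h mu).
Local Notation Xop := (Xop h mu).
Local Notation Cas r := (CasimirOp h mu r.+1).
Implicit Types (i l : 'I_n.+1) (m : 'X_{1..n.+1}) (p f : V).

Lemma CasimirOp_tot r : Cas r = tot r (Casimir h).
Proof. by []. Qed.

Lemma Casimir_act_comm r i (a : osp h) : (r < i)%N ->
  Cas r * osp_act mu i a = osp_act mu i a * Cas r.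
Proof. by move=> ri; rewrite CasimirOp_tot act_tot_comm. Qed.

Lemma Casimir_gen_comm r i g : (r < i)%N -> Cas r * act i g = act i g * Cas r.
Proof. by move=> ri; rewrite -osp_act_pgen // Casimir_act_comm. Qed.

(** Centrality is the case [s = r]. Every further factor enters through [totS] and is untouched by
    [Cas r]. *)
Lemma Casimir_tot_comm r s g : (r <= s <= n)%N ->
  Cas r * tot s (pgen g) = tot s (pgen g) * Cas r.
Proof.
move=> /andP[rs sn]; rewrite -(subnKC rs) in sn *.
elim: (s - r)%N g sn => [|t IHt] g.
  rewrite addn0 => rn; rewrite CasimirOp_tot.
  by rewrite -!(alg_morphismM (tot_morphism mu h1 rn)) Casimir_central.
rewrite addnS => tn; have {}IHt g' := IHt g' (ltnW tn).
have E g' : Cas r * act (inord (r + t).+1) g' = act (inord (r + t).+1) g' * Cas r.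
  by apply: Casimir_gen_comm; rewrite inordK // ltnS leq_addr.
rewrite totS //; case: g.
- exact: commrD (commrM (IHt gAp) (commrM (E gK) (E gP))) (commrM (IHt gKi) (E gAp)).
- exact: commrD (commrM (IHt gAm) (commrM (E gK) (E gP))) (commrM (IHt gKi) (E gAm)).
- exact: commrM (IHt gK) (E gK).
- exact: commrM (IHt gKi) (E gKi).
- exact: commrM (IHt gP) (E gP).
Qed.

Lemma Casimir_W_comm r j : (r < j)%N ->
  Cas r * \prod_(l : 'I_n.+1 | (j <= l)%N) reflX R l =
  \prod_(l : 'I_n.+1 | (j <= l)%N) reflX R l * Cas r.
Proof.
move=> rj; apply: W_comm => l jl.
exact: (Casimir_gen_comm gP (leq_trans rj jl)).
Qed.

Lemma Casimir_Dop_comm r j : (r < j <= n.+1)%N -> Cas r * Dop j = Dop j * Cas r.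
Proof.
case: j => // j /andP[rj jn]; rewrite (Dop_tot mu h1 jn).
have rjn : (r <= j <= n)%N by rewrite -ltnS rj.
exact: commrM (Casimir_tot_comm gAm rjn) (Casimir_W_comm rj).
Qed.

Lemma Casimir_Xop_comm r j : (r < j <= n.+1)%N -> Cas r * Xop j = Xop j * Cas r.
Proof.
case: j => // j /andP[rj jn]; rewrite (Xop_tot mu h1 jn).
have rjn : (r <= j <= n)%N by rewrite -ltnS rj.
exact: commrM (Casimir_tot_comm gAp rjn) (Casimir_W_comm rj).
Qed.

Lemma Casimir_CK_comm r i k : (r < i)%N ->
  Cas r * CK h mu i k = CK h mu i k * Cas r.
Proof.
move=> ri; rewrite /CK mulr_sumr mulr_suml; apply: eq_bigr => a _.
rewrite -[LHS]scalerAr -[RHS]scalerAl; congr (_ *: _).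
have cX : GRing.comm (Cas r) (mulX R i ^+ a).
  exact: (commrX _ (Casimir_gen_comm gAp ri)).
have cD : GRing.comm (Cas r) (Dop i ^+ a).
  by apply: commrX; apply: Casimir_Dop_comm; rewrite ri ltnW.
exact: (commrM cX cD).
Qed.

(** [W r.+1] fixes [p], so being killed by [Dop r.+1] means being killed by the total action of
    $A_-$. What remains of the Casimir element is diagonal. *)
Lemma Casimir_monogenic r s p : (r <= n)%N ->
  hpoly r.+1 s p -> lapp (Dop r.+1) p = 0 ->
  lapp (Cas r) p =
  ((-1) ^+ s * qnum h (s%:R + gamsum mu r.+1 - 2^-1)) *: p.
Proof.
move=> rn pP; rewrite Dop_tot // lappM (W_hpoly pP) => Dp.
have Kp : lapp (tot r (Kosp h)) p = qpow h ((gamsum mu r.+1 + s%:R) / 2) *: p.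
  by apply: hpoly_scale pP => m; exact: tot_KE.
have Kip : lapp (tot r (Kinv h)) p = qpow h (- ((gamsum mu r.+1 + s%:R) / 2)) *: p.
  by apply: hpoly_scale pP => m; exact: tot_KiE.
have Pp : lapp (tot r (Posp h)) p = (-1) ^+ s *: p.
  by apply: hpoly_scale pP => m; exact: tot_PE.
have T := tot_morphism mu h1 rn.
rewrite CasimirOp_tot /Casimir (alg_morphismM T) (alg_morphismD T) (alg_morphismN T).
rewrite (alg_morphismZ T) (alg_morphismD T) (alg_morphismN T) !(alg_morphismZ T).
rewrite !expr2 !(alg_morphismM T) [LHS]lappM Pp lappZr -[RHS]scalerA; congr (_ *: _).
rewrite [LHS]lappD [X in X + _]lappN lappM Dp {1}/lapp linear0 oppr0 add0r.
rewrite [LHS]lappZ [X in _ *: X]lappD lappN !lappZ !lappM Kp Kip !lappZr Kp Kip.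
rewrite !scalerA -scalerBl scalerA /qnum mulrC; congr (_ / _ *: _).
(* The factors $q^{\mp1/2}$ of the Casimir element shift the exponents $\pm(\gamma_{[r+1]}+s)$,
   which yields the $-\frac12$ in the eigenvalue. *)
by rewrite -!qpowD; congr (qpow h _ - qpow h _); field.
Qed.
End CasimirAction.

(** * The layers of the basis functions *)

Section Basis.
Context (R : realType) (h : R[i]) (n : nat) (mu : 'I_n.+1 -> R) (js : seq nat).
Hypothesis h1 : `|cexp h| != 1.
Hypothesis mu0 : forall i, 0 < mu i.
Local Notation Cas r := (CasimirOp h mu r.+1).

Lemma sumn_takeS m : sumn (take m.+1 js) = (sumn (take m js) + nth 0 js m)%N.
Proof.
elim: js m => [|a s IHs] [|m] //=; first by rewrite take0 addn0.
by rewrite IHs addnA.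
Qed.

Lemma psi_arg_hpoly m : (m <= n)%N ->
  hpoly m.+1 (sumn (take m.+1 js)) (psi_arg h mu js m).
Proof.
elim: m => [|m IHm] mn.
  rewrite sumn_takeS take0 add0n /= mpolyXn; apply: hpolyX; split.
    by rewrite mdegMn mdeg1 mul1n.
  by move=> i; rewrite mulmnE mnm1E lt0n -val_eqE /= eq_sym => /negPf ->; rewrite mul0n.
rewrite sumn_takeS; apply: Xop_exp_hpoly.
have iE : (inord m.+1 : 'I_n.+1) = m.+1 :> nat by rewrite inordK.
have P := IHm (ltnW mn); rewrite -{1}iE in P.
by have := CK_hpoly (h := h) (mu := mu) P; rewrite iE.
Qed.

(* The last Cauchy-Kovalevskaya extension, psi itself, is the case m = n. *)
Definition CK_stage m := lapp (CK h mu (inord m) (sumn (take m js))) (psi_arg h mu js m.-1).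

Lemma CK_stage_Casimir m : (0 < m <= n)%N ->
  lapp (Cas m) (CK_stage m) =
  ((-1) ^+ sumn (take m js) *
     qnum h ((sumn (take m js))%:R + gamsum mu m.+1 - 2^-1)) *: CK_stage m.
Proof.
case: m => // m /= mn.
have iE : (inord m.+1 : 'I_n.+1) = m.+1 :> nat by rewrite inordK.
have P := psi_arg_hpoly (ltnW mn); rewrite -{1}iE in P.
apply: Casimir_monogenic => //.
  by have := CK_hpoly (h := h) (mu := mu) P; rewrite iE.
have i0 : (0 < (inord m.+1 : 'I_n.+1))%N by rewrite iE.
by have := CK_monogenic h1 i0 (mu0 _) P; rewrite iE.
Qed.

Let s r := sumn (take r js).
Let lam r := (-1) ^+ s r * qnum h ((s r)%:R + gamsum mu r.+1 - 2^-1).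

(** $x_1^{j_1}$ need not be monogenic. But $x_1$ is the action of $A_+$ in the first factor, so it
    commutes with [Cas 0], and the constant $1$ is monogenic of degree $0$. *)
Lemma psi_arg_Casimir0 :
  lapp (Cas 0) (psi_arg h mu js 0) = lam 0 *: psi_arg h mu js 0.
Proof.
have E a : 'X_ord0 ^+ a = lapp (mulX R ord0 ^+ a) (1 : {mpoly R[i][n.+1]}).
  elim: a => [//|a IHa]; by rewrite !exprS lappM -IHa.
have cX a : Cas 0 * mulX R ord0 ^+ a = mulX R ord0 ^+ a * Cas 0.
  apply: commrX; have := Casimir_tot_comm (n := n) mu h1 (r := 0) (s := 0) gAp isT.
  by rewrite tot0.
have H1 : hpoly 1 0 (1 : {mpoly R[i][n.+1]}).
  by rewrite -mpolyX0; apply: hpolyX; split; [rewrite mdeg0|move=> i _; rewrite mnm0E].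
rewrite /= E -lappM cX lappM (Casimir_monogenic h1 _ H1) ?lappZr //.
  by rewrite /lam /s take0.
exact: Dop_hpoly0.
Qed.

(** Either [r = m] and the stage itself is monogenic, or [Cas r] passes through the outermost
    extension and the power of [Xop] below it, down to the previous stage. *)
Lemma CK_stage_eigen r m : (r <= m <= n)%N -> (0 < m)%N ->
  lapp (Cas r) (CK_stage m) = lam r *: CK_stage m.
Proof.
elim: m => // m IHm /andP[rm mn] _.
have [->|rm'] := eqVneq r m.+1; first exact: CK_stage_Casimir.
have {rm rm'} rm : (r <= m)%N by rewrite -ltnS ltn_neqAle rm' rm.
have iE : (inord m.+1 : 'I_n.+1) = m.+1 :> nat by rewrite inordK.
rewrite /CK_stage -lappM Casimir_CK_comm // ?iE // lappM -lappZr; congr lapp.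
(* Below the first extension lies no earlier stage but $x_1^{j_1}$; then [r = 0]. *)
rewrite [m.+1.-1]/=; case: m IHm rm mn iE => [|m] IHm rm mn iE.
  by move: rm; rewrite leqn0 => /eqP ->; exact: psi_arg_Casimir0.
rewrite -[psi_arg _ _ _ _]/(lapp (Xop h mu m.+2 ^+ nth 0%N js m.+1) (CK_stage m.+1)).
have c : Cas r * Xop h mu m.+2 ^+ nth 0%N js m.+1 = Xop h mu m.+2 ^+ nth 0%N js m.+1 * Cas r.
  by apply: commrX; apply: Casimir_Xop_comm; rewrite // ltnS rm ltnW.
by rewrite -lappM c lappM IHm ?lappZr // rm ltnW.
Qed.
End Basis.

Theorem proposition8 (R : realType) (q h : R[i])
    (hq0 : q != 0) (hq1 : `|q| != 1) (hlog : cexp h = q)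
    (n : nat) (hn : (3 <= n.+1)%N)
    (mu : 'I_n.+1 -> R) (hmu : forall i, 0 < mu i)
    (k l : nat) (hl : (1 <= l <= n.+1)%N)
    (j : n.-tuple nat) (hj : sumn j = k) :
  let s := sumn (take l.-1 j) in
  lapp (CasimirOp h mu l) (psi h mu j) =
  ((-1) ^+ s * qnum h (s%:R + gamsum mu l - 2^-1)) *: psi h mu j.
Proof.
rewrite -hlog in hq1; case: l hl => // r /= rn.
have n0 : (0 < n)%N by case: n hn {mu hmu j hj rn}.
(* [ord_max] is [inord n], and [take n] keeps all of a tuple of length [n]. *)
have -> : psi h mu j = CK_stage h mu j n.
  rewrite /psi /CK_stage; congr (lapp (CK h mu _ (sumn _)) _).
    by apply/val_inj; rewrite /= inordK.
  by rewrite -[X in take X](size_tuple j) take_size.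
by apply: (CK_stage_eigen j hq1 hmu _ n0); rewrite leqnn andbT.
Qed.
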